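(* The homomorphism $\phi:B_g\to\Gamma_{g,1}$, $\sigma_i\mapsto\beta_i$ ($1\le i\le g-1$), is a nongeometric embedding; that is, $\phi$ is injective, and $\phi$ does not map the standard generators $\sigma_1,\dots,\sigma_{g-1}$ of $B_g$ to Dehn twists.
   Context: $S_{g,1}$ is the compact orientable surface of genus $g$ with one boundary component, and $\Gamma_{g,1}$ is the group of isotopy classes of orientation-preserving self-homeomorphisms of $S_{g,1}$ fixing the boundary pointwise. $\pi_1S_{g,1}$ is free on standard generators $x_1,y_1,\dots,x_g,y_g$, with $R=[y_1,x_1]\cdots[y_g,x_g]$ (where $[y,x]=yxy^{-1}x^{-1}$) represented by a loop along the boundary, and $\Gamma_{g,1}$ is identified with the subgroup of $\mathrm{Aut}(\pi_1S_{g,1})$ consisting of automorphisms fixing $R$; automorphisms act on the right, so in a product $fh$ the factor $f$ is applied first. $B_g$ is the braid group on $g$ strings with standard generators $\sigma_1,\dots,\sigma_{g-1}$, where $\sigma_i$ crosses the $i$-th and $(i+1)$-st strings. With $R_i=[y_i,x_i]$, the element $\beta_i\in\Gamma_{g,1}$ is the automorphism $$x_i\mapsto R_ix_{i+1}R_i^{-1},\quad y_i\mapsto R_iy_{i+1}R_i^{-1},\quad x_{i+1}\mapsto x_i,\quad y_{i+1}\mapsto y_i,$$ fixing all the other generators. The $\beta_i$ satisfy the braid relations, so $\phi$ is a well-defined homomorphism. An embedding of a braid group into a mapping class group is called geometric if it maps the standard generators of the braid group to Dehn twists, and nongeometric otherwise. *)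

(* Defs.v *)
From HB Require Import structures.
From Stdlib Require Import Relation_Operators.
From mathcomp Require Import all_boot all_order all_algebra.
From mathcomp Require Import all_classical all_reals all_analysis.

Set Implicit Arguments.
Unset Strict Implicit.
Unset Printing Implicit Defensive.

Import Order.TTheory GRing.Theory Num.Theory.
Import numFieldNormedType.Exports.

Local Open Scope quotient_scope.

Section GeneratedEquivalence.
Variables (T : choiceType) (r : T -> T -> Prop).

Definition gen_equiv : rel T := fun x y => `[< clos_refl_sym_trans T r x y >].

Lemma gen_equiv_class : equiv_class_of gen_equiv.
Proof.
split=> [x|x y|y x z].
- by apply/asboolP; exact: rst_refl.
- by apply/asboolP/asboolP => ?; exact: rst_sym.
- by move=> /asboolP xy /asboolP yz; apply/asboolP; exact: rst_trans xy yz.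
Qed.

Canonical gen_equiv_rel := EquivRelPack gen_equiv_class.

End GeneratedEquivalence.

(* [(x, true)] is the letter x and [(x, false)] is the letter x^-1. *)
Definition word (X : Type) := seq (X * bool).
Definition inv_letter (X : Type) (l : X * bool) := (l.1, ~~ l.2).
Definition inv_word (X : Type) (w : word X) : word X :=
  rev (map (@inv_letter X) w).

Inductive word_step (X : Type) (rels : word X -> word X -> Prop) :
    word X -> word X -> Prop :=
| step_free u v l : word_step rels (u ++ l :: inv_letter l :: v) (u ++ v)
| step_rel u v r s : rels r s -> word_step rels (u ++ r ++ v) (u ++ s ++ v).

(* The group with generators X and relations r = s for [rels r s]. *)
Definition presented (X : choiceType) (rels : word X -> word X -> Prop) : Type :=
  {eq_quot @gen_equiv (seq (X * bool)) (word_step rels)}.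

Section Presented.
Local Open Scope group_scope.
Variables (X : choiceType) (rels : word X -> word X -> Prop).
Local Notation W := (seq (X * bool)).
Local Notation E := (@gen_equiv W (word_step rels)).
Local Notation P := (presented rels).

HB.instance Definition _ := Choice.on P.
HB.instance Definition _ := EqQuotient.on P.

Local Notation weq := (clos_refl_sym_trans W (word_step rels)).

Lemma presentedP (u v : W) : \pi_P u = \pi_P v <-> weq u v.
Proof.
split=> [/eqmodP/asboolP //|uv].
by apply/eqmodP/asboolP.
Qed.

Lemma weq_ctx (a b u v : W) : weq u v -> weq (a ++ u ++ b) (a ++ v ++ b).
Proof.
elim=> {u v} [u v s|u|u v _|u v w _ uv _ vw].
- apply: rst_step; case: s => [u' v' l|u' v' r s rs].
    have -> : a ++ (u' ++ l :: inv_letter l :: v') ++ b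
      = (a ++ u') ++ l :: inv_letter l :: (v' ++ b) by rewrite -!catA.
    have -> : a ++ (u' ++ v') ++ b = (a ++ u') ++ (v' ++ b) by rewrite -!catA.
    exact: step_free.
  rewrite -!catA ![a ++ u' ++ _]catA; exact: step_rel.
- exact: rst_refl.
- exact: rst_sym.
- exact: rst_trans uv vw.
Qed.

Lemma weq_cat (u u' v v' : W) : weq u u' -> weq v v' -> weq (u ++ v) (u' ++ v').
Proof.
move=> /(weq_ctx [::] v) /= uu /(weq_ctx u' [::]); rewrite !cats0.
exact: rst_trans uu.
Qed.

Lemma weq_mulV (w : W) : weq (w ++ inv_word w) [::].
Proof.
elim: w => [|l w IH]; first exact: rst_refl.
rewrite /inv_word /= rev_cons -cats1 -/(inv_word w) catA.
apply: (rst_trans _ _ _ ([:: l] ++ [::] ++ [:: inv_letter l])).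
  exact: (weq_ctx [:: l] [:: inv_letter l]).
exact: rst_step (@step_free _ _ [::] [::] l).
Qed.

Lemma inv_wordK : involutive (@inv_word X).
Proof.
move=> w; rewrite /inv_word map_rev revK -map_comp -[RHS]map_id.
by apply: eq_map => -[x b]; rewrite /inv_letter /= negbK.
Qed.

Lemma weq_Vmul (w : W) : weq (inv_word w ++ w) [::].
Proof. by rewrite -{2}[w]inv_wordK; exact: weq_mulV. Qed.

Definition pres_one : P := \pi_P [::].
Definition pres_mul (x y : P) : P := \pi_P (repr x ++ repr y).
Definition pres_inv (x : P) : P := \pi_P (inv_word (repr x)).

Lemma pres_mulE (u v : W) : pres_mul (\pi_P u) (\pi_P v) = \pi_P (u ++ v).
Proof.
by apply/presentedP/weq_cat; apply/presentedP; rewrite reprK.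
Qed.

Lemma pres_mulA : associative pres_mul.
Proof.
elim/quotW=> x; elim/quotW=> y; elim/quotW=> z.
by rewrite (pres_mulE y z) (pres_mulE x y) !pres_mulE catA.
Qed.

Lemma pres_mul1 : left_id pres_one pres_mul.
Proof. by elim/quotW=> x; rewrite [LHS]pres_mulE. Qed.

Lemma pres_1mul : right_id pres_one pres_mul.
Proof. by elim/quotW=> x; rewrite [LHS]pres_mulE cats0. Qed.

Lemma pres_mulVl : left_inverse pres_one pres_inv pres_mul.
Proof.
move=> x; rewrite -{2}[x]reprK pres_mulE; apply/presentedP; exact: weq_Vmul.
Qed.

Lemma pres_mulVr : right_inverse pres_one pres_inv pres_mul.
Proof.
move=> x; rewrite -{1}[x]reprK pres_mulE; apply/presentedP; exact: weq_mulV.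
Qed.

HB.instance Definition _ :=
  isGroup.Build P pres_mulA pres_mul1 pres_1mul pres_mulVl pres_mulVr.

Definition gen (x : X) : P := \pi_P [:: (x, true)].

Section Lift.
Variables (G : groupType) (f : X -> G).

Definition eval_letter (l : X * bool) : G := if l.2 then f l.1 else (f l.1)^-1.
Definition eval_word (w : word X) : G := foldr (fun l z => eval_letter l * z) 1 w.

Lemma eval_cat u v : eval_word (u ++ v) = eval_word u * eval_word v.
Proof. by elim: u => [|l u IH] /=; rewrite ?mul1g // IH mulgA. Qed.

Definition pres_lift of (forall r s, rels r s -> eval_word r = eval_word s) :
  P -> G := fun x => eval_word (repr x).

Hypothesis fP : forall r s, rels r s -> eval_word r = eval_word s.

Lemma eval_weq u v : weq u v -> eval_word u = eval_word v.
Proof.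
elim=> {u v} [u v|//|//|u v w _ -> _ ->//].
case=> [u' v' [x b]|u' v' r s rs].
  rewrite !eval_cat /=; congr (_ * _); rewrite mulgA.
  by case: b; rewrite /eval_letter /= ?mulgV ?mulVg mul1g.
by rewrite !eval_cat (fP rs).
Qed.

Lemma pres_liftE (w : W) : pres_lift fP (\pi_P w) = eval_word w.
Proof. by apply: eval_weq; apply/presentedP; rewrite reprK. Qed.

Lemma pres_lift_morph :
  (pres_lift fP 1 = 1) * {morph pres_lift fP : x y / (x * y)%g}.
Proof.
split=> [|x y]; first exact: (pres_liftE [::]).
rewrite -[x]reprK -[y]reprK [X in pres_lift _ X]pres_mulE.
by rewrite !pres_liftE eval_cat.
Qed.

HB.instance Definition _ := isUMagmaMorphism.Build P G (pres_lift fP) pres_lift_morph.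

Lemma pres_lift_gen x : pres_lift fP (gen x) = f x.
Proof. by rewrite /gen pres_liftE /= /eval_letter mulg1. Qed.

End Lift.

Lemma pi_word (w : W) : \pi_P w = eval_word gen w.
Proof.
elim: w => [//|l w IH].
rewrite -cat1s -[LHS]pres_mulE IH /=; congr (_ * _).
case: l => x [] //; rewrite /eval_letter /=.
apply: (@mulIg P (gen x)); rewrite mulVg.
rewrite -[LHS]/(pres_mul _ _) pres_mulE.
by apply/presentedP/rst_step; exact: (@step_free _ _ [::] [::] (x, false)).
Qed.

End Presented.

Lemma eval_morph (X : choiceType) (G H : groupType) (h : UMagmaMorphism.type G H)
  (f : X -> G) (w : word X) : h (eval_word f w) = eval_word (h \o f) w.
Proof.
elim: w => [|[x b] w IH] /=; first exact: gmulf1.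
by rewrite gmulfM IH; congr (_ * _)%g; case: b; rewrite /eval_letter //= gmulfV.
Qed.

Lemma pres_ext (X : choiceType) (rels : word X -> word X -> Prop) (G : groupType)
  (f h : UMagmaMorphism.type (presented rels) G) :
  (forall x, f (gen rels x) = h (gen rels x)) -> f =1 h.
Proof.
move=> fh z; rewrite -[z]reprK pi_word !eval_morph.
by congr (eval_word _ _); apply/funext.
Qed.

Definition no_relation (X : Type) (_ _ : word X) := False.
Notation free_group X := (presented (@no_relation X)).

Section Automorphisms.
Local Open Scope group_scope.
Variable G : groupType.

Record aut := Aut {
  aut_fun :> G -> G;
  aut_inv : G -> G;
  aut_funM : {morph aut_fun : x y / x * y};
  aut_funK : cancel aut_fun aut_inv;
  aut_invK : cancel aut_inv aut_fun }.

HB.instance Definition _ := gen_eqMixin aut.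
HB.instance Definition _ := gen_choiceMixin aut.

Lemma aut_ext (a b : aut) : a =1 b -> a = b.
Proof.
case: a b => [f f' fM fK f'K] [h h' hM hK h'K] /= fh.
have {fh} fh : f = h by apply/funext.
have fh' : f' = h'.
  by apply/funext => x; apply: (can_inj fK); rewrite f'K fh h'K.
subst h h'; congr Aut; exact: Prop_irrelevance.
Qed.

Lemma aut_invM (a : aut) : {morph aut_inv a : x y / x * y}.
Proof. by move=> x y; apply: (can_inj (aut_funK a)); rewrite aut_funM !aut_invK. Qed.

HB.instance Definition _ (a : aut) := isMultiplicative.Build G G a (@aut_funM a).

Lemma aut_fun1 (a : aut) : a 1 = 1.
Proof. by apply: (@mulgI _ (a 1)); rewrite -aut_funM !mulg1. Qed.

HB.instance Definition _ (a : aut) :=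
  Multiplicative_isUMagmaMorphism.Build G G a (aut_fun1 a).

Definition aut_one : aut :=
  @Aut id id (fun _ _ => erefl) (fun _ => erefl) (fun _ => erefl).

Definition aut_invg (a : aut) : aut :=
  @Aut (aut_inv a) a (@aut_invM a) (aut_invK a) (aut_funK a).

Lemma aut_mul_subproof (a b : aut) : {morph b \o a : x y / x * y}.
Proof. by move=> x y; rewrite /= !aut_funM. Qed.

(* Automorphisms act on the right: in the product a * b, a is applied first. *)
Definition aut_mul (a b : aut) : aut :=
  @Aut (b \o a) (aut_inv a \o aut_inv b) (@aut_mul_subproof a b)
    (can_comp (aut_funK b) (aut_funK a)) (can_comp (aut_invK a) (aut_invK b)).

Lemma aut_mulA : associative aut_mul.
Proof. by move=> a b c; apply: aut_ext. Qed.
Lemma aut_mul1 : left_id aut_one aut_mul.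
Proof. by move=> a; apply: aut_ext. Qed.
Lemma aut_1mul : right_id aut_one aut_mul.
Proof. by move=> a; apply: aut_ext. Qed.
Lemma aut_mulVl : left_inverse aut_one aut_invg aut_mul.
Proof. by move=> a; apply: aut_ext => x /=; rewrite aut_invK. Qed.
Lemma aut_mulVr : right_inverse aut_one aut_invg aut_mul.
Proof. by move=> a; apply: aut_ext => x /=; rewrite aut_funK. Qed.

HB.instance Definition _ :=
  isGroup.Build aut aut_mulA aut_mul1 aut_1mul aut_mulVl aut_mulVr.

Definition fixes (r : G) : {pred aut} := [pred a : aut | a r == r].

Lemma fixes_closed r : group_closed (fixes r).
Proof.
split=> [|a b]; first by rewrite inE.
rewrite !inE => /eqP ar /eqP br; apply/eqP.
by apply: (can_inj (aut_funK b)); rewrite /= aut_invK br ar.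
Qed.

End Automorphisms.

(* [inl i] is x_(i+1) and [inr i] is y_(i+1). *)
Definition surface_gen (g : nat) : choiceType := ('I_g + 'I_g)%type.
Notation pi1 g := (free_group (surface_gen g)).

Section MappingClassGroup.
Local Open Scope group_scope.
Variable g : nat.
Implicit Types i j : 'I_g.

Definition pi1_gen (a : surface_gen g) : pi1 g := gen _ a.
Definition xgen i : pi1 g := pi1_gen (inl i).
Definition ygen i : pi1 g := pi1_gen (inr i).
(* [y_i, x_i] = y_i x_i y_i^-1 x_i^-1, which is not MathComp's [~ y_i, x_i]. *)
Definition Rel i : pi1 g := ygen i * xgen i * (ygen i)^-1 * (xgen i)^-1.
Definition boundary_word : pi1 g := \prod_(i < g) Rel i.

(* Gamma_(g,1) *)
Definition mcg : Type := {a : aut (pi1 g) | a \in fixes boundary_word}.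

HB.instance Definition _ := [isSub for (@sval _ _ : mcg -> aut (pi1 g))].
HB.instance Definition _ := [Choice of mcg by <:].
HB.instance Definition _ :=
  SubChoice_isSubGroup.Build (aut (pi1 g)) (fixes boundary_word) mcg
    (@fixes_closed _ boundary_word).

End MappingClassGroup.

Lemma free_respects (X : choiceType) (G : groupType) (f : X -> G) (r s : word X) :
  no_relation r s -> eval_word f r = eval_word f s.
Proof. by []. Qed.

Definition free_lift (X : choiceType) (G : groupType) (f : X -> G) :
  free_group X -> G := pres_lift (free_respects f).
HB.instance Definition _ (X : choiceType) (G : groupType) (f : X -> G) :=
  UMagmaMorphism.on (free_lift f).

Definition index_lo (n : nat) (i : 'I_n.-1) : 'I_n :=
  widen_ord (leq_pred n) i.
Lemma index_hi_subproof (n : nat) (i : 'I_n.-1) : (i.+1 < n)%N.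
Proof. by rewrite -ltn_predRL. Qed.
Definition index_hi (n : nat) (i : 'I_n.-1) : 'I_n :=
  Ordinal (index_hi_subproof i).

Section Beta.
Local Open Scope group_scope.
Variable g : nat.
Implicit Types (j : 'I_g) (a : surface_gen g).

Definition index_of a : 'I_g := match a with inl j | inr j => j end.
Definition reindex a j : surface_gen g :=
  match a with inl _ => inl j | inr _ => inr j end.

Section OneIndex.
Variable i : 'I_g.-1.
Local Notation lo := (index_lo i).
Local Notation hi := (index_hi i).

Definition beta_gen a : pi1 g :=
  if index_of a == lo then
    Rel lo * pi1_gen (reindex a hi) * (Rel lo)^-1
  else if index_of a == hi then pi1_gen (reindex a lo)
  else pi1_gen a.

Definition beta_inv_gen a : pi1 g :=
  if index_of a == lo then pi1_gen (reindex a hi)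
  else if index_of a == hi then
    (Rel hi)^-1 * pi1_gen (reindex a lo) * Rel hi
  else pi1_gen a.

Lemma hi_lo : (hi == lo) = false.
Proof. by apply/negbTE; rewrite -val_eqE /= neq_ltn ltnSn orbT. Qed.

Lemma free_lift_gen (G : groupType) (f : surface_gen g -> G) a :
  free_lift f (pi1_gen a) = f a.
Proof. exact: pres_lift_gen. Qed.

Lemma morph_Rel (f : UMagmaMorphism.type (pi1 g) (pi1 g)) j :
  f (Rel j) = f (ygen j) * f (xgen j) * (f (ygen j))^-1 * (f (xgen j))^-1.
Proof. by rewrite !gmulfM !gmulfV. Qed.

Lemma conj_Rel (c x y : pi1 g) :
  (c * y * c^-1) * (c * x * c^-1) * (c * y * c^-1)^-1 * (c * x * c^-1)^-1
  = c * (y * x * y^-1 * x^-1) * c^-1.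
Proof. by rewrite !invgM !invgK !mulgA !mulgVK. Qed.

Lemma conj_mulK (G : groupType) (c x : G) : c * (c^-1 * x * c) * c^-1 = x.
Proof. by rewrite !mulgA mulgV mul1g mulgK. Qed.
Lemma conj_mulVK (G : groupType) (c x : G) : c^-1 * (c * x * c^-1) * c = x.
Proof. by rewrite !mulgA mulVg mul1g mulgVK. Qed.

Definition beta_endo := free_lift beta_gen.
Definition beta_inv_endo := free_lift beta_inv_gen.
HB.instance Definition _ := UMagmaMorphism.on beta_endo.
HB.instance Definition _ := UMagmaMorphism.on beta_inv_endo.

Lemma beta_endo_gen a : beta_endo (pi1_gen a) = beta_gen a.
Proof. exact: free_lift_gen. Qed.
Lemma beta_inv_endo_gen a : beta_inv_endo (pi1_gen a) = beta_inv_gen a.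
Proof. exact: free_lift_gen. Qed.

Lemma beta_conj (u v : pi1 g) :
  beta_endo (u * v * u^-1) = beta_endo u * beta_endo v * (beta_endo u)^-1.
Proof. by rewrite !gmulfM gmulfV. Qed.
Lemma beta_inv_conj (u v : pi1 g) : beta_inv_endo (u * v * u^-1)
  = beta_inv_endo u * beta_inv_endo v * (beta_inv_endo u)^-1.
Proof. by rewrite !gmulfM gmulfV. Qed.
Lemma beta_conjV (u v : pi1 g) :
  beta_endo (u^-1 * v * u) = (beta_endo u)^-1 * beta_endo v * beta_endo u.
Proof. by rewrite !gmulfM gmulfV. Qed.

Lemma beta_Rel j : beta_endo (Rel j) =
  if j == lo then Rel lo * Rel hi * (Rel lo)^-1
  else if j == hi then Rel lo else Rel j.
Proof.
rewrite morph_Rel /= /xgen /ygen !beta_endo_gen /beta_gen /=.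
by case: eqP => _; [rewrite conj_Rel | case: eqP].
Qed.

Lemma beta_inv_Rel j : beta_inv_endo (Rel j) =
  if j == lo then Rel hi
  else if j == hi then (Rel hi)^-1 * Rel lo * Rel hi else Rel j.
Proof.
rewrite morph_Rel /= /xgen /ygen !beta_inv_endo_gen /beta_inv_gen /=.
case: eqP => _ //; case: eqP => // _.
by rewrite -{2 4 6 8}[Rel hi]invgK conj_Rel invgK.
Qed.

Lemma reindexK a j k : reindex (reindex a j) k = reindex a k.
Proof. by case: a. Qed.
Lemma index_reindex a j : index_of (reindex a j) = j.
Proof. by case: a. Qed.
Lemma reindex_id a j : index_of a = j -> reindex a j = a.
Proof. by case: a => k /= ->. Qed.

Lemma beta_endoK : cancel beta_endo beta_inv_endo.
Proof.
move=> z; rewrite -[RHS]/(idfun z).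
rewrite -[LHS]/((beta_inv_endo \o beta_endo) z); move: z.
apply: (@pres_ext _ _ _ (beta_inv_endo \o beta_endo) idfun) => a /=.
rewrite -/(pi1_gen a) beta_endo_gen /beta_gen.
case: ifPn => [/eqP alo|nlo].
  rewrite beta_inv_conj beta_inv_Rel eqxx beta_inv_endo_gen /beta_inv_gen.
  rewrite index_reindex hi_lo eqxx reindexK reindex_id //.
  exact: conj_mulK.
case: ifPn => [/eqP ahi|nhi]; rewrite beta_inv_endo_gen /beta_inv_gen.
  by rewrite index_reindex eqxx reindexK reindex_id.
by rewrite (negbTE nlo) (negbTE nhi).
Qed.

Lemma beta_inv_endoK : cancel beta_inv_endo beta_endo.
Proof.
move=> z; rewrite -[RHS]/(idfun z).
rewrite -[LHS]/((beta_endo \o beta_inv_endo) z); move: z.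
apply: (@pres_ext _ _ _ (beta_endo \o beta_inv_endo) idfun) => a /=.
rewrite -/(pi1_gen a) beta_inv_endo_gen /beta_inv_gen.
case: ifPn => [/eqP alo|nlo].
  rewrite beta_endo_gen /beta_gen index_reindex hi_lo eqxx reindexK.
  by rewrite reindex_id.
case: ifPn => [/eqP ahi|nhi].
  rewrite beta_conjV beta_Rel hi_lo eqxx beta_endo_gen /beta_gen.
  rewrite index_reindex eqxx reindexK reindex_id //.
  exact: conj_mulVK.
by rewrite beta_endo_gen /beta_gen (negbTE nlo) (negbTE nhi).
Qed.

Definition beta_aut : aut (pi1 g) :=
  @Aut _ beta_endo beta_inv_endo (@gmulfM _ _ beta_endo) beta_endoK beta_inv_endoK.

Lemma prod_swap (G : groupType) (F H : 'I_g -> G) :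
    F lo * F hi = H lo * H hi ->
    (forall j, j != lo -> j != hi -> F j = H j) ->
  \prod_(j < g) F j = \prod_(j < g) H j.
Proof.
move=> FH FHo.
pose ext (K : 'I_g -> G) k := oapp K 1 (insub k).
have extE K : \prod_(j < g) K j = \prod_(0 <= k < g) ext K k.
  by rewrite big_mkord; apply: eq_bigr => j _; rewrite /ext valK.
have ig : (i <= g)%N by rewrite ltnW // (ltn_ord lo).
have hig : (i.+1 < g)%N := ltn_ord hi.
have eqo k : k != i :> nat -> k != i.+1 -> ext F k = ext H k.
  move=> ki khi; rewrite /ext; case: insubP => //= j _ jk.
  by apply: FHo; rewrite -val_eqE /= jk.
rewrite !extE !(@big_cat_nat _ _ _ i 0 g) //= !(@big_ltn _ _ _ i g) ?(ltnW hig) //.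
rewrite !(@big_ltn _ _ _ i.+1 g) // !mulgA; congr (_ * _).
  rewrite -2!mulgA; congr (_ * _).
    apply: eq_big_nat => k /= ki; apply: eqo; first by rewrite neq_ltn ki.
    by rewrite neq_ltn (ltn_trans ki).
  have extlo K : ext K i = K lo by rewrite /ext -[X in insub X]/(val lo) valK.
  have exthi K : ext K i.+1 = K hi by rewrite /ext -[X in insub X]/(val hi) valK.
  by rewrite !extlo !exthi.
apply: eq_big_nat => k /andP[ik _].
by apply: eqo; rewrite neq_ltn ?ik ?orbT // (ltn_trans _ ik) ?orbT.
Qed.

Lemma beta_boundary : beta_aut \in fixes (boundary_word g).
Proof.
rewrite inE; apply/eqP; rewrite /boundary_word gmulf_prod.
apply: prod_swap => /= [|j nlo nhi]; rewrite !beta_Rel.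
  by rewrite eqxx hi_lo eqxx mulgVK.
by rewrite (negbTE nlo) (negbTE nhi).
Qed.

(* beta_(i+1) *)
Definition beta : mcg g := exist _ beta_aut beta_boundary.

Lemma beta_lo a :
  beta_endo (pi1_gen (reindex a lo)) = Rel lo * pi1_gen (reindex a hi) * (Rel lo)^-1.
Proof. by rewrite beta_endo_gen /beta_gen index_reindex eqxx reindexK. Qed.
Lemma beta_hi a : beta_endo (pi1_gen (reindex a hi)) = pi1_gen (reindex a lo).
Proof. by rewrite beta_endo_gen /beta_gen index_reindex hi_lo eqxx reindexK. Qed.
Lemma beta_off a j : j != lo -> j != hi ->
  beta_endo (pi1_gen (reindex a j)) = pi1_gen (reindex a j).
Proof.
by move=> nlo nhi; rewrite beta_endo_gen /beta_gen index_reindex (negbTE nlo) (negbTE nhi).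
Qed.
Lemma betaR_lo : beta_endo (Rel lo) = Rel lo * Rel hi * (Rel lo)^-1.
Proof. by rewrite beta_Rel eqxx. Qed.
Lemma betaR_hi : beta_endo (Rel hi) = Rel lo.
Proof. by rewrite beta_Rel hi_lo eqxx. Qed.
Lemma betaR_off j : j != lo -> j != hi -> beta_endo (Rel j) = Rel j.
Proof. by move=> nlo nhi; rewrite beta_Rel (negbTE nlo) (negbTE nhi). Qed.

End OneIndex.

Lemma mcg_ext (b c : mcg g) :
  (forall a, val b (pi1_gen a) = val c (pi1_gen a)) -> b = c.
Proof.
move=> bc; apply/val_inj/aut_ext.
exact: (@pres_ext _ _ _ (val b) (val c)).
Qed.

Lemma mcg_mulE (b c : mcg g) z : val (b * c) z = val c (val b z).
Proof. by []. Qed.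

Lemma beta_val (i : 'I_g.-1) z : val (beta i) z = beta_endo i z.
Proof. by []. Qed.

Lemma beta_far (i j : 'I_g.-1) : (i.+1 < j)%N ->
  beta i * beta j = beta j * beta i.
Proof.
move=> ij; apply: mcg_ext => a; rewrite !mcg_mulE !beta_val.
have nll : index_lo i != index_lo j.
  by rewrite -val_eqE neq_ltn /= (ltn_trans _ ij).
have nlh : index_lo i != index_hi j.
  by rewrite -val_eqE neq_ltn /= ltnS ltnW // (ltn_trans _ ij).
have nhl : index_hi i != index_lo j by rewrite -val_eqE neq_ltn /= ij.
have nhh : index_hi i != index_hi j.
  by rewrite -val_eqE neq_ltn /= ltnS (ltn_trans _ ij).
have nll' := nll; have nlh' := nlh; have nhl' := nhl; have nhh' := nhh.
rewrite eq_sym in nll'; rewrite eq_sym in nlh'.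
rewrite eq_sym in nhl'; rewrite eq_sym in nhh'.
rewrite -(reindex_id (erefl (index_of a))); move: (index_of a) => k.
have [->|kli] := eqVneq k (index_lo i).
  rewrite beta_lo (beta_off a nll nlh) beta_lo beta_conj.
  by rewrite (betaR_off nll nlh) (beta_off a nhl nhh).
have [->|khi] := eqVneq k (index_hi i).
  by rewrite beta_hi (beta_off a nhl nhh) beta_hi (beta_off a nll nlh).
rewrite (beta_off a kli khi).
have [->|klj] := eqVneq k (index_lo j).
  by rewrite beta_lo beta_conj (betaR_off nll' nhl') (beta_off a nlh' nhh').
have [->|khj] := eqVneq k (index_hi j).
  by rewrite beta_hi (beta_off a nll' nhl').
by rewrite (beta_off a klj khj) (beta_off a kli khi).
Qed.

Lemma braid_conj (G : groupType) (p q x : G) :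
  p * (q * x * q^-1) * p^-1 = p * q * p^-1 * (p * x * p^-1) * (p * q * p^-1)^-1.
Proof. by rewrite !invgM !invgK !mulgA !mulgVK. Qed.

Lemma beta_near (i j : 'I_g.-1) : j = i.+1 :> nat ->
  beta i * beta j * beta i = beta j * beta i * beta j.
Proof.
move=> ij; apply: mcg_ext => a; rewrite !mcg_mulE !beta_val.
have jlo : index_lo j = index_hi i by apply: val_inj.
have nlh : index_lo i != index_hi j.
  by rewrite -val_eqE neq_ltn /= ij leqnSn.
have nll : index_lo i != index_lo j by rewrite -val_eqE neq_ltn /= ij leqnn.
have nhh : index_hi j != index_hi i.
  by rewrite -val_eqE neq_ltn /= ij ltnSn orbT.
have nhl : index_hi j != index_lo i by rewrite eq_sym.
have Bqj b : beta_endo j (pi1_gen (reindex b (index_hi i))) =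
    Rel (index_hi i) * pi1_gen (reindex b (index_hi j)) * (Rel (index_hi i))^-1.
  by rewrite -jlo beta_lo.
have Bhj b : beta_endo j (pi1_gen (reindex b (index_hi j))) =
    pi1_gen (reindex b (index_hi i)) by rewrite beta_hi jlo.
have RqJ : beta_endo j (Rel (index_hi i)) =
    Rel (index_hi i) * Rel (index_hi j) * (Rel (index_hi i))^-1.
  by rewrite -jlo betaR_lo.
rewrite -(reindex_id (erefl (index_of a))); move: (index_of a) => k.
have [->|kli] := eqVneq k (index_lo i).
  rewrite (beta_off a nll nlh) beta_lo !beta_conj (betaR_off nll nlh) Bqj.
  rewrite !beta_conj betaR_lo betaR_hi (beta_off a nhl nhh).
  by rewrite -braid_conj.
have [->|khi] := eqVneq k (index_hi i).
  rewrite Bqj beta_hi (beta_off a nll nlh) beta_lo !beta_conj betaR_hi.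
  by rewrite (beta_off a nhl nhh) (betaR_off nll nlh) Bhj.
have [->|khj] := eqVneq k (index_hi j).
  by rewrite (beta_off a nhl nhh) Bhj beta_hi (beta_off a nll nlh).
have klj : k != index_lo j by rewrite jlo.
by rewrite !((beta_off a klj khj), (beta_off a kli khi)).
Qed.

End Beta.

Section Braid.
Local Open Scope group_scope.
Variable n : nat.

Inductive braid_rel : word 'I_n.-1 -> word 'I_n.-1 -> Prop :=
| braid_rel_far (i j : 'I_n.-1) : (i.+1 < j)%N ->
    braid_rel [:: (i, true); (j, true)] [:: (j, true); (i, true)]
| braid_rel_near (i j : 'I_n.-1) : j = i.+1 :> nat ->
    braid_rel [:: (i, true); (j, true); (i, true)]
              [:: (j, true); (i, true); (j, true)].

(* Artin's presentation *)
Definition braid_group : Type := presented braid_rel.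
HB.instance Definition _ := Group.on braid_group.

(* sigma_(i+1) *)
Definition sigma (i : 'I_n.-1) : braid_group := gen braid_rel i.

Lemma beta_respects (r s : word 'I_n.-1) :
  braid_rel r s -> eval_word (@beta n) r = eval_word (@beta n) s.
Proof.
case=> [i j ij|i j ij]; rewrite /= /eval_letter /= !mulg1.
  exact: beta_far.
by rewrite !mulgA; exact: beta_near.
Qed.

Definition phi : braid_group -> mcg n := pres_lift beta_respects.
HB.instance Definition _ := UMagmaMorphism.on phi.

Lemma phi_sigma (i : 'I_n.-1) : phi (sigma i) = beta i.
Proof. exact: pres_lift_gen. Qed.

End Braid.

(* A model of S_(g,1): the rectangle [0, 4g] x [0, 1], a polygon whose top side
   is cut into 4g edges of length 1, the j-th block of four edges being glued
   according to the word y_j x_j y_j^-1 x_j^-1.  All the points (k, 1) with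
   k = 0, ..., 4g become one point, the base point; the left, bottom and right
   sides form the boundary circle, and the boundary loop from (0, 1) to (4g, 1)
   is homotopic to the top side, which reads R = R_1 ... R_g.  For 0 < g this is
   a compact orientable surface of genus g with one boundary component. *)
Section Surface.
Local Open Scope classical_set_scope.
Local Open Scope ring_scope.
Variables (R : realType) (g : nat).

Definition rectangle : set (R * R) :=
  [set p | 0 <= p.1 <= (4 * g)%:R /\ 0 <= p.2 <= 1].

Notation polygon := (set_type rectangle).

Lemma corner_subproof : (0, 1) \in rectangle.
Proof. by apply/mem_set; split; rewrite /= ?lexx ?ler0n ?ler01. Qed.
Definition corner : polygon := exist _ (0, 1) corner_subproof.

(* The point (x, y), used for (x, y) in the rectangle only. *)
Definition pt (x y : R) : polygon := insubd corner (x, y).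

Inductive edge_glue : polygon -> polygon -> Prop :=
| edge_glue_y (j : 'I_g) (t : R) : 0 <= t <= 1 ->
    edge_glue (pt ((4 * j)%:R + t) 1) (pt ((4 * j)%:R + 3 - t) 1)
| edge_glue_x (j : 'I_g) (t : R) : 0 <= t <= 1 ->
    edge_glue (pt ((4 * j)%:R + 1 + t) 1) (pt ((4 * j)%:R + 4 - t) 1).

Definition surface : Type := quotient_topology {eq_quot (gen_equiv edge_glue)}.
HB.instance Definition _ := Topological.on surface.
HB.instance Definition _ := Quotient.on surface.

Definition boundary : set surface :=
  [set \pi_surface p | p in
    [set p : polygon | [\/ (val p).1 = 0, (val p).1 = (4 * g)%:R | (val p).2 = 0]]].

Definition base_point : surface := \pi_surface corner.

(* Paths are functions of which only the values on [0, 1] matter. *)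
Definition path_homotopic (a b : R -> surface) : Prop :=
  exists H : R * R -> surface,
    [/\ {within [set p | 0 <= p.1 <= 1 /\ 0 <= p.2 <= 1], continuous H},
        forall t, 0 <= t <= 1 -> H (t, 0) = a t /\ H (t, 1) = b t
      & forall s, 0 <= s <= 1 -> H (0, s) = a 0 /\ H (1, s) = a 1].

Definition path_cat (a b : R -> surface) : R -> surface :=
  fun t => if t <= 2^-1 then a (2 * t) else b (2 * t - 1).
Definition path_rev (a : R -> surface) : R -> surface := fun t => a (1 - t).

Definition gen_loop (a : surface_gen g) : R -> surface := fun t =>
  match a with
  | inl j => \pi_surface (pt ((4 * j)%:R + 1 + t) 1)
  | inr j => \pi_surface (pt ((4 * j)%:R + t) 1)
  end.

Definition letter_loop (l : surface_gen g * bool) : R -> surface :=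
  if l.2 then gen_loop l.1 else path_rev (gen_loop l.1).

Definition word_loop (w : word (surface_gen g)) : R -> surface :=
  foldr (fun l c => path_cat (letter_loop l) c) (fun=> base_point) w.

(* T, a homeomorphism fixing the boundary pointwise (and hence preserving the
   orientation), induces f on pi_1. *)
Definition represents (T : surface -> surface) (f : mcg g) : Prop :=
  forall a, path_homotopic (T \o gen_loop a) (word_loop (repr (val f (pi1_gen a)))).

Definition boundary_homeo (T : surface -> surface) : Prop :=
  [/\ continuous T,
      exists T', [/\ continuous T', cancel T T' & cancel T' T]
    & forall s, boundary s -> T s = s].

Definition strip : set (R * R) := [set p | 0 <= p.2 <= 1].

(* An embedding of the annulus (R / Z) x [0, 1], as a map on R x [0, 1]. *)
Definition annulus_embedding (e : R * R -> surface) : Prop :=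
  {within strip, continuous e} /\
  forall p q, strip p -> strip q ->
    (e p = e q <-> (exists k : int, p.1 = q.1 + k%:~R) /\ p.2 = q.2).

(* T is the Dehn twist about the core of the annulus e: it is
   (u, t) |-> (u + t, t) on the annulus and the identity elsewhere.  As e may
   reverse the orientation, left and right twists are both covered. *)
Definition twist_along (e : R * R -> surface) (T : surface -> surface) : Prop :=
  (forall p, strip p -> T (e p) = e (p.1 + p.2, p.2)) /\
  (forall s, ~ (e @` strip) s -> T s = s).

Definition is_dehn_twist (f : mcg g) : Prop :=
  exists T : surface -> surface,
    [/\ boundary_homeo T,
        exists2 e, annulus_embedding e & twist_along e T
      & represents T f].

End Surface.

Definition is_geometric (R : realType) (n g : nat) (f : braid_group n -> mcg g) : Prop :=
  forall i : 'I_n.-1, is_dehn_twist R (f (sigma i)).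

(* Main.v *)
(* Injectivity follows Chow. Any braid on m + 2 strands is a b c, where c is a
   coset representative carrying the last strand to its final position, b is a
   braid on the first m + 1 strands, and a lies in the subgroup generated by the
   pure braids A_k linking strand k to the last strand. If it acts trivially on
   the surface group, then c = 1, and forgetting the last handle shows that b
   acts trivially, hence b = 1 by induction. Finally a conjugates x_(m+2) by an
   element which, once the last handle is forgotten, is the word in the
   commutators R_k spelled by a. This element commutes with x_(m+2), hence dies
   when the last handle is forgotten, and the R_k are free: so a = 1.

   A Dehn twist T along an annulus changes the winding number of a loop, with
   respect to a map from the surface to R / Z, by a multiple of the winding
   number of the core of the annulus. Some nonzero integral combination theta of
   the maps dual to x_i and y_i does not wind around the core, and then
   theta o T - theta lifts to a continuous real function on the surface, so that
   T preserves winding numbers with respect to theta. But beta_i exchanges the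
   homology classes of x_i and x_(i+1), and of y_i and y_(i+1). *)
Require Import Defs.
From HB Require Import structures.
From mathcomp Require Import all_boot all_order all_algebra.
From mathcomp Require Import all_classical all_reals all_analysis.
From mathcomp Require Import zify ring lra.

Set Implicit Arguments.
Unset Strict Implicit.
Unset Printing Implicit Defensive.

(** * Combing braids *)

Section Span.
Local Open Scope group_scope.
Variable G : groupType.

Inductive grp_span (S : G -> Prop) : G -> Prop :=
| span_one : grp_span S 1
| span_gen x : S x -> grp_span S x
| span_mul x y : grp_span S x -> grp_span S y -> grp_span S (x * y)
| span_inv x : grp_span S x -> grp_span S x^-1.

Lemma span_right_ind (S P : G -> Prop) :
    P 1 -> (forall z x, S x -> P z -> P (z * x) /\ P (z * x^-1)) ->
  forall z, grp_span S z -> P z.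
Proof.
(* Stability of [P] under right multiplication by both [y] and [y^-1] passes to products and
   inverses, so induction on the span applies. *)
move=> P1 PS; suff Pr y : grp_span S y -> forall z, P z -> P (z * y) /\ P (z * y^-1).
  by move=> z /Pr /(_ 1 P1)[]; rewrite mul1g.
elim=> {y} [z Pz|x Sx z|x y _ IHx _ IHy z Pz|x _ IHx z /IHx[]].
- by rewrite invg1 mulg1.
- exact: PS.
- rewrite invgM !mulgA; split; first by apply IHy, IHx.
  by apply IHx, IHy.
- by rewrite invgK.
Qed.

End Span.

Section Combing.
Local Open Scope group_scope.
Variables (G : groupType) (s : nat -> G) (m : nat).
Hypothesis far : forall i j, i.+1 < j <= m -> s i * s j = s j * s i.
Hypothesis near : forall i, i < m ->
  s i * s i.+1 * s i = s i.+1 * s i * s i.+1.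

Fixpoint descend d : G := if d is e.+1 then descend e * s (m - e) else 1.

(* [coset_rep k] is s_m s_(m-1) ... s_k: it moves strand m + 1 to position k. *)
Definition coset_rep k := descend (m.+1 - k).
Local Notation c := coset_rep.

(** As [x ^ y^-1] is [y * x * y^-1], this is Artin's generator s_m ... s_(k+1) s_k^2 s_(k+1)^-1 ...
    s_m^-1: a full twist of strand k with the last one. *)
Definition pure_gen k := (s k * s k) ^ (c k.+1)^-1.
Local Notation A := pure_gen.
Local Notation spanA := (grp_span (fun x => exists2 k, k <= m & x = A k)).
Local Notation spanS n := (grp_span (fun x => exists2 k, k < n & x = s k)).

Lemma coset_rep_last : c m.+1 = 1.
Proof. by rewrite /c subnn. Qed.

Lemma coset_repS k : k <= m -> c k = c k.+1 * s k.
Proof. by move=> km; rewrite /c subSn //= subSS subKn. Qed.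

Lemma down_ind (P : nat -> Prop) :
  P m.+1 -> (forall k, k <= m -> P k.+1 -> P k) -> forall k, k <= m.+1 -> P k.
Proof.
move=> Pm PS k km; rewrite -(subKn km); elim: (m.+1 - k) => [|d IH].
  by rewrite subn0.
have [dm|md] := leqP d m; last by rewrite subSS (_ : m - d = m.+1 - d)//; lia.
by rewrite subSS; apply: PS; rewrite ?leq_subr // -subSn.
Qed.

(** Every factor of [c k] has index at least [k], hence is far from [s j]. *)
Lemma coset_rep_low j k : k <= m.+1 -> j.+1 < k -> s j * c k = c k * s j.
Proof.
move: k; apply: down_ind => [_|k km IH jk].
  by rewrite coset_rep_last mulg1 mul1g.
by rewrite (coset_repS km) mulgA (IH (leqW jk)) -!mulgA (@far j k) // jk.
Qed.

(** The braid relation acts once, where [s j] meets the factors [s j.+1 * s j] of [c k] and comes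
    out as [s j.+1]; all the other factors commute past. *)
Lemma coset_rep_shift j k : j < m -> k <= j -> s j * c k = c k * s j.+1.
Proof.
move=> jm kj; have km : k <= m.+1 by lia.
move: k km kj; apply: down_ind => [|k km IH kj]; first lia.
have [jk|jk] := eqVneq j k.
  subst k; rewrite (coset_repS km) (@coset_repS j.+1) // !mulgA.
  by rewrite coset_rep_low // -!mulgA; congr (_ * _); rewrite !mulgA near.
rewrite (coset_repS km) mulgA IH; last lia.
by rewrite -!mulgA (@far k j.+1) //; lia.
Qed.

Lemma shift_conjV (x x' y z : G) : x * y = y * x' -> (z ^ y^-1) ^ x = (z ^ x') ^ y^-1.
Proof.
by move=> xy; rewrite -!conjgM; congr (_ ^ _); apply: (@mulgI _ y);
  rewrite mulVKg mulgA -xy mulgK.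
Qed.

Lemma commute_conjV (x y z : G) : commute x y -> (z ^ y^-1) ^ x = (z ^ x) ^ y^-1.
Proof. exact: shift_conjV. Qed.

Lemma pure_gen_fix (x : G) k : commute x (c k.+1) -> commute x (s k) -> A k ^ x = A k.
Proof.
move=> xc xs; rewrite commute_conjV //; congr (_ ^ _).
by rewrite conjMg /conjg -xs mulKg.
Qed.

Lemma sqJ (x y : G) : (x * x) ^ y = x ^ y * x ^ y.
Proof. exact: conjMg. Qed.

Lemma near_conj k : k < m -> (s k ^ (s k.+1)^-1) ^ (s k)^-1 = s k.+1.
Proof.
move=> km; rewrite -conjgM -invgM conjgE invgK mulgA near //.
by rewrite -(mulgA (s k.+1)) mulgK.
Qed.

Lemma near_conjV k : k < m -> s k.+1 ^ (s k)^-1 = s k ^ s k.+1.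
Proof.
move=> km; rewrite !conjgE invgK; apply: (@mulgI _ (s k.+1)).
by rewrite !mulgA mulgV mul1g; apply: (@mulIg _ (s k)); rewrite mulgVK near.
Qed.

Lemma pure_gen_up k : k < m -> A k ^ (s k)^-1 = A k.+1.
Proof.
move=> km; rewrite /A coset_repS // invgM conjgM commute_conjV; last first.
  by apply/commute_sym/commuteV/commute_sym; rewrite /commute coset_rep_low.
by congr (_ ^ _); rewrite !(sqJ (s k)) sqJ near_conj.
Qed.

Lemma pure_gen_down k : k < m -> A k.+1 ^ (s k)^-1 = A k ^ A k.+1.
Proof.
move=> km; rewrite /A (coset_repS km) invgM (conjgM _ (s k.+1)^-1) -(conjJg _ _ (c k.+2)^-1).
rewrite commute_conjV; last first.
  by apply/commute_sym/commuteV/commute_sym; rewrite /commute coset_rep_low.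
by congr (_ ^ _); rewrite conjgM conjgKV (sqJ (s k.+1)) (sqJ (s k)) near_conjV.
Qed.

Lemma pure_gen_upV k : k < m -> A k.+1 ^ s k = A k.
Proof. by move=> km; rewrite -pure_gen_up // conjgKV. Qed.

Lemma pure_gen_downV k : k < m -> A k ^ s k = A k.+1 ^ (A k)^-1.
Proof.
move=> km; apply: (canRL (conjgK _)); rewrite -{2}(pure_gen_upV km).
by rewrite -conjJg -pure_gen_down // conjgKV.
Qed.

(** Far crossings fix [A k]; those with index [k] or [k.-1] replace it by a neighbouring generator,
    up to conjugation by some [A]. The index [j = m], which moves the last strand, is excluded. *)
Lemma pure_gen_norm j k : j < m -> k <= m -> spanA (A k ^ s j) /\ spanA (A k ^ (s j)^-1).
Proof.
move=> jm km.
have spA i : i <= m -> spanA (A i) by move=> im; apply: span_gen; exists i.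
have spJ x y : spanA x -> spanA y -> spanA (x ^ y).
  by move=> Ax Ay; apply: span_mul (span_inv Ay) (span_mul Ax Ay).
have [jk|jk|jk] := ltngtP j k.
- have [jk'|jk'] := eqVneq j.+1 k; last first.
    have jc : commute (s j) (c k.+1) by apply: coset_rep_low; lia.
    have js : commute (s j) (s k) by apply: far; lia.
    rewrite !pure_gen_fix //; first by split; exact: spA.
      by apply/commute_sym/commuteV/commute_sym.
    by apply/commute_sym/commuteV/commute_sym.
  subst k; rewrite pure_gen_upV // pure_gen_down //.
  by split; [exact/spA/ltnW|apply: spJ; apply: spA; lia].
(* For [k < j], moving [s j] past [c k.+1] turns it into [s j.+1], which is far from [s k]. *)
- have jc : s j * c k.+1 = c k.+1 * s j.+1 by apply: coset_rep_shift; lia.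
  have js : commute (s j.+1) (s k) by apply/commute_sym/far; lia.
  have fx : A k ^ s j = A k.
    rewrite /A (shift_conjV _ jc); congr (_ ^ _).
    by rewrite conjMg /conjg -js mulKg.
  split; first by rewrite fx; exact: spA.
  by rewrite -fx conjgK; exact: spA.
- subst k; rewrite pure_gen_up // pure_gen_downV //.
  by split; [apply: spJ; [exact: spA|exact/span_inv/spA]|exact: spA].
Qed.

Lemma pure_norm b a : spanS m b -> spanA a -> spanA (a ^ b).
Proof.
suff nb : spanS m b -> forall a, spanA a -> spanA (a ^ b) /\ spanA (a ^ b^-1).
  by move=> Sb Aa; apply nb.
elim=> {a b} [a Aa|_ [j jm ->] a|b b' _ IHb _ IHb' a Aa|b _ IHb a /IHb[]].
- by rewrite invg1 conjg1.
- elim=> {a} [|_ [k km ->]|x y _ [xp xn] _ [yp yn]|x _ [xp xn]].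
  + by rewrite !conj1g; split; exact: span_one.
  + exact: pure_gen_norm.
  + by rewrite !conjMg; split; exact: span_mul.
  + by rewrite !conjVg; split; exact: span_inv.
- rewrite invgM !conjgM; split; first by apply IHb', IHb.
  by apply IHb, IHb'.
- by rewrite invgK.
Qed.

(** Multiply a normal form by one crossing. For [j] equal to [k.-1] or [k], the coset representative
    gets longer or shorter, possibly leaving a factor [A j] or its inverse, which moves left across
    [b] by normality. Otherwise the crossing passes through [c k], as [s j] or as [s j.-1], and
    joins [b]. *)
Lemma combing z : spanS m.+1 z -> exists a b k,
  [/\ spanA a, spanS m b, k <= m.+1 & z = a * b * c k].
Proof.
move: z; apply: span_right_ind.
  exists 1, 1, m.+1; rewrite coset_rep_last !mulg1.
  by split => //; exact: span_one.
move=> _ _ [j jm ->] [a [b [k [Aa Sb km ->]]]].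
have spS i : i < m -> spanS m (s i) by move=> im; apply: span_gen; exists i.
have spA i : i <= m -> spanA (A i) by move=> im; apply: span_gen; exists i.
have Ab i : i <= m -> spanA (A i ^ b^-1).
  by move=> im; apply: pure_norm (spA _ im); exact: span_inv.
have swap x y : a * b * (x * y) = a * (x ^ b^-1) * b * y.
  by rewrite conjgE invgK !mulgA mulgVK.
have sq i : i <= m -> c i * s i = A i * c i.+1.
  by move=> im; rewrite coset_repS // /A conjgE invgK !mulgA mulgVK.
have sqV i : i <= m -> c i.+1 * (s i)^-1 = (A i)^-1 * c i.
  move=> im; apply: (@mulIg _ (s i)); rewrite mulgVK -mulgA sq // mulKg //.
have pass i : i < m -> c k * s j = s i * c k ->
    (exists a' b' k', [/\ spanA a', spanS m b', k' <= m.+1 & a * b * c k * s j = a' * b' * c k'])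
  /\ (exists a' b' k', [/\ spanA a', spanS m b', k' <= m.+1 & a * b * c k * (s j)^-1 = a' * b' * c k']).
  move=> im cs; split.
    exists a, (b * s i), k; split=> //; first exact: span_mul (spS _ im).
    by rewrite -!mulgA cs.
  exists a, (b * (s i)^-1), k; split=> //.
    exact: span_mul (span_inv (spS _ im)).
  by apply: (@mulIg _ (s j)); rewrite mulgVK -!mulgA cs mulKg.
have [jk|jk|jk] := ltngtP j k; last 1 first.
- subst k; split.
    exists (a * (A j ^ b^-1)), b, j.+1; split=> //; first exact: span_mul (Ab _ _).
    by rewrite -mulgA sq // swap.
  exists a, b, j.+1; split=> //; by rewrite coset_repS // !mulgA mulgK.
- have [jk'|jk'] := eqVneq j.+1 k; last by apply: (pass j); [lia|rewrite coset_rep_low //; lia].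
  subst k; split.
    by exists a, b, j; split=> //; [lia|rewrite -mulgA -coset_repS].
  exists (a * ((A j)^-1 ^ b^-1)), b, j; split=> //; last by rewrite -mulgA sqV // swap.
    by apply: span_mul => //; rewrite conjVg; apply/span_inv/Ab.
  by lia.
- have j0 : 0 < j by lia.
  by apply: (pass j.-1); [lia|rewrite coset_rep_shift ?prednK //; lia].
Qed.

End Combing.

(** * The surface group *)

Section Bijections.
Local Open Scope group_scope.
Variable T : Type.

Record bij := Bij {
  bij_fun :> T -> T;
  bij_inv : T -> T;
  bij_funK : cancel bij_fun bij_inv;
  bij_invK : cancel bij_inv bij_fun }.

HB.instance Definition _ := gen_eqMixin bij.
HB.instance Definition _ := gen_choiceMixin bij.

Lemma bij_ext (a b : bij) : a =1 b -> a = b.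
Proof.
case: a b => [f f' fK f'K] [h h' hK h'K] /= fh.
have {fh} fh : f = h by apply/funext.
have fh' : f' = h' by apply/funext => x; apply: (can_inj fK); rewrite f'K fh h'K.
subst h h'; congr Bij; exact: Prop_irrelevance.
Qed.

Definition bij_one : bij := @Bij id id (fun _ => erefl) (fun _ => erefl).
Definition bij_invg (a : bij) : bij := @Bij (bij_inv a) a (bij_invK a) (bij_funK a).
(** Bijections act on the left, unlike [aut]: in [a * b] the factor [b] is applied first. *)
Definition bij_mul (a b : bij) : bij :=
  @Bij (a \o b) (bij_inv b \o bij_inv a)
    (can_comp (bij_funK a) (bij_funK b)) (can_comp (bij_invK b) (bij_invK a)).

Lemma bij_mulA : associative bij_mul.
Proof. by move=> a b c; apply: bij_ext. Qed.
Lemma bij_mul1 : left_id bij_one bij_mul.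
Proof. by move=> a; apply: bij_ext. Qed.
Lemma bij_1mul : right_id bij_one bij_mul.
Proof. by move=> a; apply: bij_ext. Qed.
Lemma bij_mulVl : left_inverse bij_one bij_invg bij_mul.
Proof. by move=> a; apply: bij_ext => x /=; rewrite bij_funK. Qed.
Lemma bij_mulVr : right_inverse bij_one bij_invg bij_mul.
Proof. by move=> a; apply: bij_ext => x /=; rewrite bij_invK. Qed.

HB.instance Definition _ :=
  isGroup.Build bij bij_mulA bij_mul1 bij_1mul bij_mulVl bij_mulVr.

Lemma bijM (a b : bij) x : (a * b) x = a (b x). Proof. by []. Qed.
Lemma bijV (a : bij) x y : a x = y -> a^-1 y = x.
Proof. by move=> <-; exact: bij_funK. Qed.

End Bijections.

Lemma presented_span (X : choiceType) (rels : Defs.word X -> Defs.word X -> Prop)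
  (u : presented rels) : grp_span (fun z => exists x, z = gen rels x) u.
Proof.
rewrite -[u]reprK pi_word;  elim: (repr u : Defs.word X) => [|[x b] w IH] /=; first exact: span_one.
apply: span_mul => //; rewrite /eval_letter /=.
have gx : grp_span (fun z => exists x, z = gen rels x) (gen rels x).
  by apply: span_gen; exists x.
by case: b => //; exact: span_inv.
Qed.

(** * Generators indexed by natural numbers, freeness of the commutators, and centralizers *)

Section Strands.
Local Open Scope group_scope.
Variable g : nat.
Implicit Types (b : bool) (k l n : nat).

Definition strand_gen b (j : 'I_g) : surface_gen g := if b then inl j else inr j.

(* [strand true k] is x_(k+1) and [strand false k] is y_(k+1); both are 1 for
   [g <= k]. *)
Definition strand b k : pi1 g :=
  if insub k is Some j then pi1_gen (strand_gen b j) else 1.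

Definition comm k : pi1 g :=
  strand false k * strand true k * (strand false k)^-1 * (strand true k)^-1.

Lemma strandE b (j : 'I_g) : strand b j = pi1_gen (strand_gen b j).
Proof. by rewrite /strand valK. Qed.

Lemma commE (j : 'I_g) : comm j = Rel j.
Proof. by rewrite /comm !strandE. Qed.

Lemma strand_ind (P : pi1 g -> Prop) :
    P 1 -> (forall b k, k < g -> P (strand b k)) ->
    (forall x y, P x -> P y -> P (x * y)) -> (forall x, P x -> P x^-1) ->
  forall z, P z.
Proof.
move=> P1 Pg PM PV z; elim: (presented_span z) => {z} //; last first.
- by move=> x _; exact: PV.
- by move=> x y _ Px _; exact: PM.
move=> _ [[j|j] ->].
- by have := Pg true j (ltn_ord j); rewrite strandE.
- by have := Pg false j (ltn_ord j); rewrite strandE.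
Qed.

Lemma morph1 (G H : groupType) (f : G -> H) : {morph f : x y / x * y} -> f 1 = 1.
Proof. by move=> fM; apply: (@mulgI _ (f 1)); rewrite -fM !mulg1. Qed.

Lemma morphV (G H : groupType) (f : G -> H) :
  {morph f : x y / x * y} -> {morph f : x / x^-1}.
Proof.
by move=> fM x; apply: (@mulgI _ (f x)); rewrite -fM !mulgV (morph1 fM).
Qed.

Lemma morphJ (G H : groupType) (f : G -> H) x y : {morph f : x y / x * y} ->
  f (x * y * x^-1) = f x * f y * (f x)^-1.
Proof. by move=> fM; rewrite !fM (morphV fM). Qed.

Lemma strand_ext (H : groupType) (f h : pi1 g -> H) :
    {morph f : x y / x * y} -> {morph h : x y / x * y} ->
  (forall b k, k < g -> f (strand b k) = h (strand b k)) -> f =1 h.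
Proof.
move=> fM hM fh; apply: strand_ind => //.
- by rewrite (morph1 fM) (morph1 hM).
- by move=> x y fx fy; rewrite fM hM fx fy.
- by move=> x fx; rewrite (morphV fM) (morphV hM) fx.
Qed.

Lemma morph_comm (f : pi1 g -> pi1 g) k : {morph f : x y / x * y} ->
  f (comm k) = f (strand false k) * f (strand true k)
               * (f (strand false k))^-1 * (f (strand true k))^-1.
Proof. by move=> fM; rewrite /comm !fM !(morphV fM). Qed.

Section FreeLift.
Variables (H : groupType) (f : bool -> nat -> H).

Definition strand_lift : pi1 g -> H :=
  free_lift (fun a : surface_gen g => f (if a is inl _ then true else false) (index_of a)).
HB.instance Definition _ := UMagmaMorphism.on strand_lift.

Lemma strand_liftM : {morph strand_lift : x y / x * y}.
Proof. exact: gmulfM. Qed.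

Lemma strand_liftE b k : k < g -> strand_lift (strand b k) = f b k.
Proof.
move=> kg; rewrite -[k]/(val (Ordinal kg)) strandE /strand_lift /pi1_gen.
by rewrite /free_lift pres_lift_gen; case: b.
Qed.
End FreeLift.

(* The representation on [free_group 'I_n * bool] where x_j exchanges the two
   sheets and y_j multiplies by t_j on the first sheet only: on that sheet,
   [y_j, x_j] is the multiplication by t_j. *)
Section CommFree.
Variable n : nat.
Hypothesis ng : n <= g.
Local Notation F := (free_group 'I_n).

Definition sheet_gen k : F := if insub k is Some j then gen _ j else 1.

Lemma flipK : involutive (fun p : F * bool => (p.1, ~~ p.2)).
Proof. by case=> w b /=; rewrite negbK. Qed.
Lemma sheetK (t : F) : cancel (fun p : F * bool => (if p.2 then t * p.1 else p.1, p.2))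
   (fun p : F * bool => (if p.2 then t^-1 * p.1 else p.1, p.2)).
Proof. by case=> w [] //=; rewrite mulKg. Qed.
Lemma sheetVK (t : F) : cancel (fun p : F * bool => (if p.2 then t^-1 * p.1 else p.1, p.2))
   (fun p : F * bool => (if p.2 then t * p.1 else p.1, p.2)).
Proof. by case=> w [] //=; rewrite mulVKg. Qed.

Definition sheet_rep := strand_lift (fun b k =>
  if b then Bij flipK flipK else Bij (sheetK (sheet_gen k)) (sheetVK (sheet_gen k))).
Lemma sheet_repM : {morph sheet_rep : x y / x * y}.
Proof. exact: strand_liftM. Qed.

Definition comm_lift : F -> pi1 g := free_lift (fun i : 'I_n => comm i).
Lemma comm_liftM : {morph comm_lift : x y / x * y}.
Proof. exact: gmulfM. Qed.

Lemma comm_liftE (i : 'I_n) : comm_lift (gen _ i) = comm i.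
Proof. exact: pres_lift_gen. Qed.

(** The sheet representation of [comm_lift u] sends (1, true) to (u, true), so that [u] can be read
    off. *)
Lemma comm_lift_inj (u : F) : comm_lift u = 1 -> u = 1.
Proof.
have rep_comm (i : 'I_n) w : sheet_rep (comm i) (w, true) = (gen _ i * w, true).
  have ig := leq_trans (ltn_ord i) ng.
  have repE b : sheet_rep (strand b i) = _ := strand_liftE _ b ig.
  by rewrite /comm !sheet_repM !(morphV sheet_repM) !repE /sheet_gen valK.
have rep v w : sheet_rep (comm_lift v) (w, true) = (v * w, true).
  elim: (presented_span v) w => {v} [w|_ [i ->] w|x y _ IHx _ IHy w|x _ IH w].
  - by rewrite (morph1 comm_liftM) (morph1 sheet_repM) mul1g.
  - by rewrite comm_liftE rep_comm.
  - by rewrite comm_liftM sheet_repM bijM IHy IHx mulgA.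
  - by rewrite (morphV comm_liftM) (morphV sheet_repM); apply: bijV; rewrite IH mulVKg.
by move=> u1; have := rep u 1; rewrite u1 (morph1 sheet_repM) mulg1 => -[].
Qed.

End CommFree.

(** The retraction that forgets handle [n]. *)
Definition kill n : pi1 g -> pi1 g :=
  strand_lift (fun b k => if k == n then 1 else strand b k).
Lemma killM n : {morph kill n : x y / x * y}.
Proof. exact: strand_liftM. Qed.

Lemma kill_strand n b k : kill n (strand b k) = if k == n then 1 else strand b k.
Proof.
have [kg|gk] := ltnP k g; first by rewrite /kill strand_liftE.
by rewrite /strand insubF ?(morph1 (killM n)) ?if_same //; apply/negbTE; rewrite -leqNgt.
Qed.

(* The representation on [pi1 g * bool] through [kill n], except that x_n
   exchanges (1, true) and (1, false). *)
Section Centralizer.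
Variable n : nat.
Hypothesis ng : n < g.

Lemma kill_flipK : involutive (fun p : pi1 g * bool => (p.1, (p.1 == 1) (+) p.2)).
Proof. by case=> w b /=; rewrite addbA addbb. Qed.
Lemma transK (t : pi1 g) : cancel (fun p : pi1 g * bool => (t * p.1, p.2))
  (fun p : pi1 g * bool => (t^-1 * p.1, p.2)).
Proof. by case=> w b /=; rewrite mulKg. Qed.
Lemma transVK (t : pi1 g) : cancel (fun p : pi1 g * bool => (t^-1 * p.1, p.2))
  (fun p : pi1 g * bool => (t * p.1, p.2)).
Proof. by case=> w b /=; rewrite mulVKg. Qed.

Definition kill_rep := strand_lift (fun b k =>
  if (k == n) && b then Bij kill_flipK kill_flipK
  else Bij (transK (kill n (strand b k))) (transVK (kill n (strand b k)))).
Lemma kill_repM : {morph kill_rep : x y / x * y}.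
Proof. exact: strand_liftM. Qed.

Lemma kill_rep_fst w p : (kill_rep w p).1 = kill n w * p.1.
Proof.
move: w p; apply: strand_ind => [p|b k kg p|x y IHx IHy p|x IH p].
- by rewrite (morph1 kill_repM) (morph1 (killM n)) mul1g.
- rewrite /kill_rep strand_liftE // kill_strand.
  by case: eqP => //= _; case: b => //=; rewrite mul1g.
- by rewrite kill_repM killM bijM IHx IHy mulgA.
- rewrite (morphV kill_repM) (morphV (killM n)); move: (IH ((kill_rep x)^-1 p)); rewrite -bijM mulgV => ->.
  by rewrite mulKg.
Qed.

(** Apply both products to (1, true). If [kill n w] were not 1, then x_n would fix the image of (1,
    true) under [w]; commutation would give (1, true) and (1, false) the same image under [w]. *)
Lemma strand_centralizer w : w * strand true n * w^-1 = strand true n -> kill n w = 1.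
Proof.
move=> wx; have {}wx : w * strand true n = strand true n * w by rewrite -[in RHS]wx mulgVK.
have := congr1 (fun z => kill_rep z (1, true)) wx; rewrite /= !kill_repM !bijM.
have -> : kill_rep (strand true n) = Bij kill_flipK kill_flipK.
  by rewrite /kill_rep strand_liftE ?eqxx.
move: (kill_rep_fst w (1, true)); rewrite mulg1 => vw.
rewrite /= eqxx /= -vw; case: eqVneq => // _ /=.
by rewrite -surjective_pairing => /(can_inj (bij_funK (kill_rep w))).
Qed.

Lemma strand_neq1 b k : k < g -> strand b k != 1.
Proof.
move=> kg; apply/eqP => /(congr1 (@strand_lift _ (fun b' _ => if b' == b then
  Bij negbK negbK else 1))); rewrite (morph1 (@strand_liftM _ _)) strand_liftE // eqxx.
by move=> /(congr1 (fun f => bij_fun f true)).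
Qed.

End Centralizer.

End Strands.

(** * Faithfulness of the action *)

Lemma gen_rel (X : choiceType) (rels : Defs.word X -> Defs.word X -> Prop) r r' :
  rels r r' -> eval_word (gen rels) r = eval_word (gen rels) r'.
Proof.
move=> rr'; rewrite -!pi_word; apply/presentedP/Relation_Operators.rst_step.
by have := step_rel [::] [::] rr'; rewrite !cats0.
Qed.

Section Action.
Local Open Scope group_scope.
Variable g : nat.
Implicit Types (b : bool) (k l n : nat) (z : braid_group g) (w : pi1 g).

Local Notation strand := (@strand g).
Local Notation comm := (@comm g).

Definition act z w : pi1 g := val (phi z) w.

Lemma actE z1 z2 w : act (z1 * z2) w = act z2 (act z1 w).
Proof. by rewrite /act gmulfM. Qed.

Lemma act1 w : act 1 w = w.
Proof. by rewrite /act gmulf1. Qed.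

Lemma actM z : {morph act z : x y / x * y}.
Proof. exact: aut_funM. Qed.

Lemma actK z : cancel (act z) (act z^-1).
Proof. by move=> w; rewrite -actE mulgV act1. Qed.

Lemma actVK z : cancel (act z^-1) (act z).
Proof. by move=> w; rewrite -actE mulVg act1. Qed.

Lemma actJ z x y : act z (x * y * x^-1) = act z x * act z y * (act z x)^-1.
Proof. exact: morphJ (actM z). Qed.

(** Indexing by natural numbers, with the value 1 out of range, matches the family [s] of the
    combing. *)
Definition sg k : braid_group g := if insub k is Some i then sigma i else 1.

Lemma sgE (i : 'I_g.-1) : sg i = sigma i.
Proof. by rewrite /sg valK. Qed.

Lemma sg_far i j : i.+1 < j < g.-1 -> sg i * sg j = sg j * sg i.
Proof.
move=> /andP[ij jg]; have ig : i < g.-1 by lia.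
rewrite (sgE (Ordinal ig)) (sgE (Ordinal jg)).
by have := gen_rel (@braid_rel_far g (Ordinal ig) (Ordinal jg) ij);
  rewrite /= /eval_letter /= !mulg1.
Qed.

Lemma sg_near i : i.+1 < g.-1 ->
  sg i * sg i.+1 * sg i = sg i.+1 * sg i * sg i.+1.
Proof.
move=> jg; have ig : i < g.-1 by lia.
rewrite (sgE (Ordinal ig)) (sgE (Ordinal jg)).
by have := gen_rel (@braid_rel_near g (Ordinal ig) (Ordinal jg) erefl);
  rewrite /= /eval_letter /= !mulg1 !mulgA.
Qed.

Lemma braid_span z : grp_span (fun x => exists2 k, k < g.-1 & x = sg k) z.
Proof.
elim: (presented_span z) => {z} [|_ [i ->]|x y _ Sx _ Sy|x _ Sx].
- exact: span_one.
- by apply: span_gen; exists i; rewrite ?sgE.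
- exact: span_mul.
- exact: span_inv.
Qed.

Lemma sg_lo b k : k.+1 < g -> act (sg k) (strand b k) = comm k * strand b k.+1 * (comm k)^-1.
Proof.
move=> kg; have ig : k < g.-1 by lia.
pose i := Ordinal ig; rewrite (sgE i) /act phi_sigma beta_val.
rewrite (strandE b (index_lo i)) (strandE b (index_hi i)) (commE (index_lo i)).
by case: b; [exact: (@beta_lo g i (inl (index_lo i)))|exact: (@beta_lo g i (inr (index_lo i)))].
Qed.

Lemma sg_hi b k : k.+1 < g -> act (sg k) (strand b k.+1) = strand b k.
Proof.
move=> kg; have ig : k < g.-1 by lia.
pose i := Ordinal ig; rewrite (sgE i) /act phi_sigma beta_val.
rewrite (strandE b (index_lo i)) (strandE b (index_hi i)).
by case: b; [exact: (@beta_hi g i (inl (index_lo i)))|exact: (@beta_hi g i (inr (index_lo i)))].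
Qed.

Lemma sg_off b k l : l != k -> l != k.+1 -> act (sg k) (strand b l) = strand b l.
Proof.
move=> lk lk'; rewrite /sg; case: insubP => [i _ ik|_]; last exact: act1.
have [lg|gl] := ltnP l g; last first.
  by rewrite /strand insubF ?(morph1 (actM _)) //; apply/negbTE; rewrite -leqNgt.
rewrite -[l]/(val (Ordinal lg)) strandE /act phi_sigma beta_val.
have nlo : Ordinal lg != index_lo i by rewrite -val_eqE /= ik.
have nhi : Ordinal lg != index_hi i by rewrite -val_eqE /= ik.
by case: b; [exact: (@beta_off g i (inl (index_lo i)) _ nlo nhi)
            |exact: (@beta_off g i (inr (index_lo i)) _ nlo nhi)].
Qed.

(** * A crossing seen after forgetting one of its two strands *)

Section Transposition.
Variable k : nat.
Hypothesis kg : k.+1 < g.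

Definition transp l := if l == k then k.+1 else if l == k.+1 then k else l.

Lemma transpK : involutive transp.
Proof. by move=> l; rewrite /transp; repeat case: eqP; lia. Qed.

Lemma transp_lt l : l < g -> transp l < g.
Proof. by rewrite /transp; case: eqP => // _; case: eqP => // _; lia. Qed.

Definition swap : pi1 g -> pi1 g := strand_lift (fun b l => strand b (transp l)).

Lemma swapM : {morph swap : x y / x * y}.
Proof. exact: strand_liftM. Qed.

Lemma swap_strand b l : l < g -> swap (strand b l) = strand b (transp l).
Proof. by move=> lg; rewrite /swap strand_liftE. Qed.

Lemma killcM n z : {morph kill n \o act z : x y / x * y}.
Proof. by move=> x y; rewrite /= actM killM. Qed.

(* Once strand k or k + 1 is forgotten, the crossing of the two strands is only
   a transposition. *)
Lemma kill_lo w : kill k (act (sg k) w) = swap (kill k.+1 w).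
Proof.
move: w; apply: strand_ext => [||b l lg /=]; first exact: killcM.
  by move=> x y; rewrite killM swapM.
have [->|lk] := eqVneq l k.
  rewrite sg_lo // !killM !(morphV (killM _)) !killM !(morphV (killM _)) !kill_strand.
  rewrite eqxx (gtn_eqF (ltnSn k)) (ltn_eqF (ltnSn k)) swap_strand ?(ltnW kg) //.
  by rewrite /transp eqxx !(invg1, mulg1, mul1g).
have [->|lk'] := eqVneq l k.+1.
  by rewrite sg_hi // !kill_strand !eqxx (morph1 swapM).
rewrite sg_off // !kill_strand (negbTE lk) (negbTE lk') swap_strand //.
by rewrite /transp (negbTE lk) (negbTE lk').
Qed.

Lemma kill_hi w : kill k.+1 (act (sg k) w) = swap (kill k w).
Proof.
move: w; apply: strand_ext => [||b l lg /=]; first exact: killcM.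
  by move=> x y; rewrite killM swapM.
have [->|lk] := eqVneq l k.
  rewrite sg_lo // (morphJ _ _ (killM _)) !kill_strand !eqxx.
  by rewrite mulg1 mulgV (morph1 swapM).
have [->|lk'] := eqVneq l k.+1.
  rewrite sg_hi // !kill_strand (gtn_eqF (ltnSn k)) (ltn_eqF (ltnSn k)) swap_strand //.
  by rewrite /transp (gtn_eqF (ltnSn k)) eqxx.
rewrite sg_off // !kill_strand (negbTE lk) (negbTE lk') swap_strand //.
by rewrite /transp (negbTE lk) (negbTE lk').
Qed.

Lemma swapK : involutive swap.
Proof.
apply: (@strand_ext _ _ (swap \o swap) idfun) => [x y|//|b l lg] /=.
  by rewrite !swapM.
by rewrite !swap_strand ?transpK ?transp_lt.
Qed.

End Transposition.

Lemma span_act (S : braid_group g -> Prop) w :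
    (forall x, S x -> act x w = w) ->
  forall z, grp_span S z -> act z w = w.
Proof.
move=> Sw z; elim=> {z} [|x /Sw //|x y _ xw _ yw|x _ xw]; first exact: act1.
  by rewrite actE xw.
by rewrite -{1}xw actK.
Qed.

(** * Adding one strand: the action of coset representatives and of pure braids *)

Section Step.
Variable m : nat.
Hypothesis mg : m.+1 < g.
Local Notation c := (coset_rep sg m).
Local Notation A := (pure_gen sg m).
Local Notation n := m.+1.

Lemma coset_act_low b k l : l < k <= n -> act (c k) (strand b l) = strand b l.
Proof.
move=> /andP[lk km]; move: k km lk.
apply: (@down_ind m (fun k => l < k -> _)) => [_|k km IH lk].
  by rewrite coset_rep_last act1.
by rewrite coset_repS // actE IH ?leqW // sg_off //; lia.
Qed.

(** Each factor of [c k] lowers the handle by one through [sg_hi], which introduces no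
    conjugation. *)
Lemma coset_act b k : k <= n -> act (c k) (strand b n) = strand b k.
Proof.
move: k; apply: down_ind => [|k km IH]; first by rewrite coset_rep_last act1.
by rewrite coset_repS // actE IH sg_hi //; lia.
Qed.

(** Undoing [c k] brings handle [k] back to position [n], so forgetting [n] afterwards depends only
    on what is left once [k] is forgotten. [T] collects the transpositions. *)
Lemma coset_kill k : k <= n ->
  exists T : pi1 g -> pi1 g, forall w, kill n (act (c k)^-1 w) = T (kill k w).
Proof.
move: k; apply: down_ind => [|k km [T TE]].
  by exists id => w; rewrite coset_rep_last invg1 act1.
exists (T \o swap k) => w; rewrite coset_repS // invgM actE TE /=.
have kg : k.+1 < g by lia.
by rewrite -[in RHS](actVK (sg k) w) kill_lo // swapK.
Qed.

(** Once the last handle is forgotten, the two crossings of the full twist become the same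
    transposition, and they cancel. *)
Lemma pure_kill k w : k <= m -> kill n (act (A k) w) = kill n w.
Proof.
move=> km; have kg : k.+1 < g by lia.
have [T TE] := coset_kill (km : k.+1 <= n).
by rewrite /pure_gen conjgE invgK !actE TE kill_hi // kill_lo // swapK // -TE actK.
Qed.

Lemma pure_act k : k <= m ->
  act (A k) (strand true n) = comm k * strand true n * (comm k)^-1.
Proof.
move=> km; have kg : k.+1 < g by lia.
have cV b l : l < k.+1 -> act (c k.+1)^-1 (strand b l) = strand b l.
  by move=> lk; rewrite -{1}(@coset_act_low b k.+1 l) ?actK //; lia.
have cVn b : act (c k.+1)^-1 (strand b k.+1) = strand b n.
  by rewrite -coset_act ?actK.
(* The handle travels from n to k + 1, then to k, then back to k + 1 with conjugator [comm k]. The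
   final inverse of [c k.+1] returns it to n and fixes [comm k]. *)
rewrite /pure_gen conjgE invgK !actE coset_act // sg_hi // sg_lo // actJ cVn.
by rewrite (morph_comm _ (actM _)) !cV.
Qed.

(* [v] is recovered from the action of [z] on x_n, up to the choice of the
   conjugator [w]: see [strand_centralizer]. *)
Definition conj_kill z v :=
  (exists2 w, act z (strand true n) = w * strand true n * w^-1 & kill n w = v)
  /\ forall w, kill n (act z w) = kill n w.

Definition pure_lift : free_group 'I_n -> braid_group g :=
  free_lift (fun i : 'I_n => A i : braid_group g).

Lemma pure_liftM : {morph pure_lift : x y / x * y}.
Proof. exact: gmulfM. Qed.

Lemma pure_liftE i : pure_lift (gen _ i) = A i.
Proof. exact: pres_lift_gen. Qed.

Lemma kill_comm k : k < n -> kill n (comm k) = comm k.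
Proof. by move=> kn; rewrite (morph_comm _ (killM n)) !kill_strand ltn_eqF. Qed.

Lemma kill_span z w : grp_span (fun x => exists2 k, k < m & x = sg k) z ->
  kill n (act z w) = act z (kill n w).
Proof.
move=> Sz; elim: Sz w => {z} [w|_ [k km ->]|x y _ IHx _ IHy w|x _ IH w].
- by rewrite !act1.
- have kg : k.+1 < g by lia.
  apply: strand_ext => [||b l lg /=]; first exact: killcM.
    by move=> x y; rewrite killM actM.
  rewrite [kill n (strand b l)]kill_strand.
  have [->|lk] := eqVneq l k.
    by rewrite ltn_eqF ?ltnS ?(ltnW km) // sg_lo // (morphJ _ _ (killM _)) kill_comm ?kill_strand ?ltn_eqF ?ltnS // ltnW.
  have [->|lk'] := eqVneq l k.+1; first by rewrite ltn_eqF // sg_hi // kill_strand ltn_eqF // ltnS ltnW.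
  by rewrite sg_off // kill_strand; case: eqP => _; rewrite ?(morph1 (actM _)) // sg_off.
- by rewrite !actE IHy IHx.
- by rewrite -[in LHS](actVK x w) -[w in RHS](actVK x w) IH !actK.
Qed.

(** A product [x * y] has conjugator [act y w * w']. Since [y] acts trivially after forgetting the
    last handle, the forgotten conjugators multiply in the order of the word. *)
Lemma conj_kill_lift u : conj_kill (pure_lift u) (comm_lift g u).
Proof.
elim: (presented_span u) => {u} [|_ [i ->]|x y _ [[w xw wx] xk] _ [[w' yw wy] yk]|x _ [[w xw wx] xk]].
- rewrite (morph1 pure_liftM) (morph1 (@comm_liftM g n)); split=> [|w]; last by rewrite act1.
  by exists 1; rewrite ?(morph1 (killM _)) // act1 mul1g invg1 mulg1.
- rewrite pure_liftE comm_liftE; have im : i <= m := ltn_ord i.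
  split=> [|w]; last exact: pure_kill.
  by exists (comm i); [rewrite pure_act|rewrite kill_comm].
- rewrite pure_liftM comm_liftM -wx -wy; split=> [|v]; last by rewrite actE yk.
  exists (act (pure_lift y) w * w'); last by rewrite killM yk.
  by rewrite actE xw actJ yw invgM !mulgA.
- rewrite (morphV pure_liftM) (morphV (@comm_liftM g n)) -wx.
  have xVk v : kill n (act (pure_lift x)^-1 v) = kill n v.
    by rewrite -[RHS](congr1 (kill n) (actVK (pure_lift x) v)) xk.
  split=> //; exists (act (pure_lift x)^-1 w)^-1; last first.
    by rewrite (morphV (killM _)) xVk.
  have := congr1 (act (pure_lift x)^-1) xw; rewrite actK actJ => e; rewrite [in RHS]e.
  by rewrite invgK !mulgA mulVg mul1g mulgVK.
Qed.

Lemma pure_span_lift a : grp_span (fun x => exists2 k, k <= m & x = A k) a ->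
  exists u, a = pure_lift u.
Proof.
elim=> {a} [|_ [k km ->]|x y _ [u ->] _ [v ->]|x _ [u ->]].
- by exists 1; rewrite (morph1 pure_liftM).
- by exists (gen _ (Ordinal (km : k < n))); rewrite pure_liftE.
- by exists (u * v); rewrite pure_liftM.
- by exists u^-1; rewrite (morphV pure_liftM).
Qed.

End Step.

(** Induction on the number m + 1 of strands involved, inside a fixed [braid_group g], so that all
    the braids act on the same surface group. *)
Lemma act_faithful m z : m < g -> grp_span (fun x => exists2 k, k < m & x = sg k) z ->
  (forall w, act z w = w) -> z = 1.
Proof.
elim: m z => [|m IHm] z mg Sz z1.
  elim: Sz => {z z1} [//|x [] //|x y _ -> _ ->|x _ ->]; first exact: mulg1.
  exact: invg1.
have far i j : i.+1 < j <= m -> sg i * sg j = sg j * sg i by move=> ?; apply: sg_far; lia.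
have near i : i < m -> sg i * sg i.+1 * sg i = sg i.+1 * sg i * sg i.+1.
  by move=> ?; apply: sg_near; lia.
have [a [b [k [/pure_span_lift [u ->] Sb km zE]]]] := combing far near Sz.
have [[w aw wu] ak] := conj_kill_lift mg u.
have bn b' l : m < l -> act b (strand b' l) = strand b' l.
  by move=> ml; apply: span_act Sb => _ [i im ->]; apply: sg_off; lia.
(* Otherwise [z] sends x_n, with n = m + 1, to a conjugate of x_k; forgetting handle [k] would turn
   this equality into x_n = 1. *)
have {km} kn : k = m.+1.
  apply/eqP/negPn/negP => nk; have := z1 (strand true m.+1).
  rewrite zE !actE aw !actJ bn // coset_act // => /(congr1 (kill k)).
  rewrite !(morphJ _ _ (killM _)) !kill_strand eqxx mulg1 mulgV eq_sym (negbTE nk).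
  by move/esym/eqP; rewrite (negbTE (strand_neq1 _ mg)).
rewrite kn coset_rep_last mulg1 in zE.
(* The inverse of [b] acts as the pure factor does. It fixes the handles beyond m; on the first ones
   it commutes with forgetting the last handle, after which the pure factor is trivial. *)
have b1 : b = 1.
  apply/esym/invg_inj; rewrite invg1; apply/esym/IHm; [exact: ltnW|exact: span_inv|].
  have abE x : act (pure_lift u) x = act b^-1 x.
    by apply: (can_inj (actVK b^-1)); rewrite invgK actVK -actE -zE z1.
  apply: strand_ext => [||b' l lg] //; first exact: actM.
  have [ml|lm] := ltnP m l; first by rewrite -{1}(bn b' l ml) actK.
  have kl : kill m.+1 (strand b' l) = strand b' l by rewrite kill_strand ltn_eqF.
  by rewrite -{1}kl -(kill_span mg) ?abE; [rewrite -abE ak|exact: span_inv].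
rewrite b1 mulg1 in zE; rewrite zE in z1 *.
have u1 : u = 1.
  apply: (comm_lift_inj (ltnW mg)); rewrite -wu; apply: (strand_centralizer mg).
  by rewrite -aw z1.
by rewrite u1 (morph1 (@pure_liftM m)).
Qed.

Lemma phi_inj : injective (@phi g).
Proof.
move=> x y xy; apply/divg1_eq.
(* For g = 0 the bound [g.-1 < g] fails, but there are no generators at all. *)
have [g0|g0] := posnP g.
  elim: (braid_span (x / y)) => {xy} [//|z [k]|z t _ -> _ ->|z _ ->].
  - by lia.
  - exact: mulg1.
  - exact: invg1.
apply: (@act_faithful g.-1); rewrite ?prednK //; first exact: braid_span.
by move=> w; rewrite actE /act xy -/(act _ _) actK.
Qed.
End Action.

(** * Maps to R / Z *)

Import Order.TTheory GRing.Theory Num.Theory.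
Import numFieldNormedType.Exports.

Section ModZ.
Local Open Scope classical_set_scope.
Local Open Scope ring_scope.
Variable R : realType.
Implicit Types (e a b : R) (p q : R * R).

Definition eqZ (x y : R) := exists n : int, x - y = n%:~R.

Lemma eqZ_refl (x : R) : eqZ x x.
Proof. by exists 0; rewrite subrr. Qed.
Lemma eqZ_sym (x y : R) : eqZ x y -> eqZ y x.
Proof. by case=> n xy; exists (- n); rewrite -opprB xy mulrNz. Qed.
Lemma eqZ_trans (x y z : R) : eqZ x y -> eqZ y z -> eqZ x z.
Proof. by case=> n xy [k yz]; exists (n + k); rewrite intrD -xy -yz; ring. Qed.
Lemma eqZD (x y x' y' : R) : eqZ x y -> eqZ x' y' -> eqZ (x + x') (y + y').
Proof. by case=> n xy [k xy']; exists (n + k); rewrite intrD -xy -xy'; ring. Qed.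
Lemma eqZM (c : int) (x y : R) : eqZ x y -> eqZ (c%:~R * x) (c%:~R * y).
Proof. by case=> n xy; exists (c * n); rewrite intrM -xy; ring. Qed.
Lemma eqZ_int (n : int) : eqZ n%:~R 0.
Proof. by exists n; rewrite subr0. Qed.

Lemma int_lt1 (n : int) : `|n%:~R : R| < 1 -> n = 0.
Proof. by rewrite -intr_norm -[1]/(1%:~R) ltr_int; lia. Qed.

(** Distance less than [e] in the quotient metric of R / Z. *)
Definition zclose e (x y : R) := exists n : int, `|x - y - n%:~R| < e.

Lemma zclose_eqZ e (x x' y y' : R) : eqZ x x' -> eqZ y y' -> zclose e x y -> zclose e x' y'.
Proof.
move=> [n xx'] [k yy'] [m xy]; exists (m - n + k).
by apply: le_lt_trans xy; rewrite intrD intrB -xx' -yy' le_eqVlt; apply/orP; left;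
  apply/eqP; congr `|_|; ring.
Qed.

Lemma zclose_refl e (x : R) : 0 < e -> zclose e x x.
Proof. by move=> e0; exists 0; rewrite !subrr normr0. Qed.
Lemma zclose_sym e (x y : R) : zclose e x y -> zclose e y x.
Proof.
case=> n xy; exists (- n); rewrite -normrN.
by have -> : - (y - x - (- n)%:~R) = x - y - n%:~R by rewrite mulrNz; ring.
Qed.
Lemma zcloseD e e' (x y x' y' : R) :
  zclose e x y -> zclose e' x' y' -> zclose (e + e') (x + x') (y + y').
Proof.
move=> [n xy] [k xy']; exists (n + k); apply: le_lt_trans (ltrD xy xy').
by apply: le_trans (ler_normD _ _); rewrite intrD le_eqVlt; apply/orP; left;
  apply/eqP; congr `|_|; ring.
Qed.
Lemma zclose_trans e e' (x y z : R) : zclose e x y -> zclose e' y z -> zclose (e + e') x z.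
Proof.
by move=> xy /(zcloseD xy) [n h]; exists n; apply: le_lt_trans h; rewrite le_eqVlt;
  apply/orP; left; apply/eqP; congr `|_|; ring.
Qed.
Lemma zcloseN e (x y : R) : zclose e x y -> zclose e (- x) (- y).
Proof.
case=> n xy; exists (- n); rewrite -normrN.
by have -> : - (- x - - y - (- n)%:~R) = x - y - n%:~R by rewrite mulrNz; ring.
Qed.


(* Continuity of [f] as a map to R / Z. *)
Definition zcont (X : topologicalType) (f : X -> R) :=
  forall (x : X) e, 0 < e -> \forall y \near x, zclose e (f y) (f x).

Lemma zcontD (X : topologicalType) (f h : X -> R) :
  zcont f -> zcont h -> zcont (fun x => f x + h x).
Proof.
move=> fc hc x e e0; have e2 : 0 < e / 2 by lra.
near=> y; rewrite [e](splitr e); apply: zcloseD; near: y; [exact: fc|exact: hc].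
Unshelve. all: end_near. Qed.

Lemma zcontN (X : topologicalType) (f : X -> R) : zcont f -> zcont (fun x => - f x).
Proof.
move=> fc x e e0; near=> y; apply: zcloseN; near: y; exact: fc.
Unshelve. all: end_near. Qed.

Lemma zcontM (c : int) (X : topologicalType) (f : X -> R) :
  zcont f -> zcont (fun x => c%:~R * f x).
Proof.
move=> fc x e e0; have c1 : 0 < `|c%:~R : R| + 1 by apply: ltr_wpDl.
have ec : 0 < e / (`|c%:~R| + 1) by rewrite divr_gt0.
near=> y; have [n h] : zclose (e / (`|c%:~R| + 1)) (f y) (f x) by near: y; exact: fc.
exists (c * n); rewrite intrM -!mulrBr normrM.
move: h; rewrite ltr_pdivlMr // => h; apply: le_lt_trans h.
by rewrite mulrC ler_wpM2l // lerDl.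
Unshelve. all: end_near. Qed.

Lemma zcont_comp (X Y : topologicalType) (f : X -> R) (h : Y -> X) :
  continuous h -> zcont f -> zcont (f \o h).
Proof. by move=> hc fc y e e0; exact: (hc y _ (fc (h y) e e0)). Qed.

Lemma within_comp (X Y Z : topologicalType) (A : set X) (f : X -> Z) (h : Y -> X) :
    continuous h -> (forall y, A (h y)) -> {within A, continuous f} ->
  continuous (f \o h).
Proof.
move=> hc hA /subspace_continuousP fc y W /= Wf.
have := fc (h y) (hA y) W Wf; rewrite /= => fW.
have hW : \forall z \near y, A (h z) -> W (f (h z)) := hc y _ fW.
suff : \forall z \near y, W (f (h z)) by [].
by near=> z; apply: (near hW z) => //; near: z.
Unshelve. all: end_near. Qed.

(* Meaningful only for [x] at distance less than 1/4 from an integer, which is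
   then unique. *)
Definition residue (x : R) := x - (xget 0 [set n : int | `|x - n%:~R| < 4^-1])%:~R.

Lemma residue_eqZ (x : R) : eqZ (residue x) x.
Proof.
rewrite /residue; set n := xget _ _; exists (- n); by rewrite mulrNz; ring.
Qed.

Lemma residue_small (x : R) : zclose 4^-1 x 0 -> `|residue x| < 4^-1.
Proof.
by case=> n; rewrite subr0 => xn; exact: (@xgetPex _ 0 [set n : int | `|x - n%:~R| < 4^-1] (ex_intro _ n xn)).
Qed.

Lemma residue_continuous (X : topologicalType) (f : X -> R) :
  zcont f -> (forall x, zclose 4^-1 (f x) 0) -> continuous (residue \o f).
Proof.
move=> fc fs x; apply/(@cvgrPdist_lt _ R^o) => e e0 /=.
(* Residues are smaller than 1/4, so two of them differ by less than 1/2. Being also within 1/2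
   modulo the integer [n], they force [n] to be 0. *)
have m0 : 0 < Num.min e (2^-1 : R) by rewrite lt_min e0 /=; lra.
near=> y; have : zclose (Num.min e 2^-1) (residue (f y)) (residue (f x)).
  apply: (@zclose_eqZ _ (f y) _ (f x)); try exact/eqZ_sym/residue_eqZ.
  by near: y; exact: fc.
case=> n; rewrite lt_min => /andP[ne n2].
have rx := residue_small (fs x); have ry := residue_small (fs y).
suff n0 : n = 0 by move: ne; rewrite n0 subr0 distrC.
apply: int_lt1; move: n2 rx ry; rewrite !ltr_norml; lra.
Unshelve. all: end_near. Qed.

(** For [0 <= a], the retraction of the line onto [0, a]. Composing with it turns continuity on an
    interval into continuity everywhere. *)
Definition clamp a (x : R) : R := Num.max 0 (Num.min x a).

Lemma clamp_itv a (x : R) : 0 <= a -> 0 <= clamp a x <= a.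
Proof. by move=> a0; rewrite /clamp le_max lexx /= ge_max a0 ge_min lexx orbT. Qed.

Lemma clamp_id a (x : R) : 0 <= x <= a -> clamp a x = x.
Proof. by move=> /andP[x0 xa]; rewrite /clamp min_l // max_r. Qed.

Lemma clamp_le0 a (x : R) : 0 <= a -> x <= 0 -> clamp a x = 0.
Proof. by move=> a0 x0; rewrite /clamp min_l ?max_l //; exact: le_trans a0. Qed.

Lemma clamp_ge a (x : R) : 0 <= a -> a <= x -> clamp a x = a.
Proof. by move=> a0 ax; rewrite /clamp min_r ?max_r. Qed.

Lemma clamp_continuous a : continuous (clamp a).
Proof.
move=> x; apply: (@continuous_max R R (fun=> 0) (fun x => Num.min x a)); first exact: cvg_cst.
apply: (@continuous_min R R id (fun=> a)); [exact: cvg_id|exact: cvg_cst].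
Qed.

Definition rect a b : set (R * R) := [set p | 0 <= p.1 <= a /\ 0 <= p.2 <= b].

Definition clamp2 a b p := (clamp a p.1, clamp b p.2).

Lemma clamp2_rect a b p : 0 <= a -> 0 <= b -> rect a b (clamp2 a b p).
Proof. by move=> a0 b0; split; exact: clamp_itv. Qed.

Lemma clamp2_id a b p : rect a b p -> clamp2 a b p = p.
Proof. by case: p => x y [/= xa yb]; rewrite /clamp2 !clamp_id. Qed.

Lemma pair_continuous (X Y Z : topologicalType) (f : X -> Y) (h : X -> Z) :
  continuous f -> continuous h -> continuous (fun x => (f x, h x)).
Proof. by move=> fc hc x; exact: cvg_pair (fc x) (hc x). Qed.

Lemma fst_continuous (X Y : topologicalType) : continuous (@fst X Y).
Proof. by move=> x; exact: cvg_fst. Qed.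

Lemma snd_continuous (X Y : topologicalType) : continuous (@snd X Y).
Proof. by move=> x; exact: cvg_snd. Qed.

Lemma comp_continuous (X Y Z : topologicalType) (f : X -> Y) (h : Y -> Z) :
  continuous f -> continuous h -> continuous (h \o f).
Proof. by move=> fc hc x; apply: continuous_comp; [exact: fc|exact: hc]. Qed.

Lemma clamp2_continuous a b : continuous (clamp2 a b).
Proof.
apply: pair_continuous; (apply: comp_continuous; last exact: clamp_continuous).
  exact: fst_continuous.
exact: snd_continuous.
Qed.

Lemma rect_compact a b : compact (rect a b).
Proof.
have -> : rect a b = `[0, a]%classic `*` `[0, b]%classic.
  by apply/seteqP; split=> p; rewrite /rect /= !in_itv.
by apply: compact_setX; exact: segment_compact.
Qed.

Definition scale (x : R) p : R * R := (x * p.1, x * p.2).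

Lemma scale_continuous (x : R) : continuous (scale x).
Proof.
have mc : continuous (fun y : R => x * y) by move=> y; exact: mulrl_continuous.
apply: pair_continuous; (apply: comp_continuous; last exact: mc).
  exact: fst_continuous.
exact: snd_continuous.
Qed.

Lemma scale_rect a b (x : R) p : 0 <= x <= 1 -> rect a b p -> rect a b (scale x p).
Proof.
move=> /andP[x0 x1] [/andP[p0 pa] /andP[q0 qb]]; rewrite /rect /= !mulr_ge0 //=.
split; first by apply: le_trans pa; rewrite ler_piMl.
by apply: le_trans qb; rewrite ler_piMl.
Qed.

Lemma rect_uniform a b (f : R * R -> R) : zcont f ->
  exists N : nat, forall p q, rect a b p -> rect a b q ->
    `|p.1 - q.1| <= (a + b) / N.+1%:R -> `|p.2 - q.2| <= (a + b) / N.+1%:R ->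
    zclose 4^-1 (f p) (f q).
Proof.
move=> fc; pose P N p := forall q, rect a b q ->
  `|p.1 - q.1| <= (a + b) / N.+1%:R -> `|p.2 - q.2| <= (a + b) / N.+1%:R ->
  zclose 4^-1 (f p) (f q).
have /compact_near_coveringP/(_ nat \oo P _) [x rx|N _ NP] := @rect_compact a b; last first.
  by exists N => p q pK; exact: (NP N (leqnn N) p pK).
(* Two values within 1/8 of [f x] are within 1/4 of each other; likewise the radius [d] is split in
   two halves. *)
have e8 : 0 < (8^-1 : R) by lra.
have /nbhs_ballP[d /= d0 dx] := fc x _ e8.
have d2 : 0 < d / 2 by lra.
exists (ball x (d / 2), [set N : nat | (a + b) / N.+1%:R < d / 2]); last first.
  case=> p N [/= px Nd] q qK pq1 pq2; rewrite (_ : 4^-1 = 8^-1 + 8^-1 :> R); last lra.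
  apply: (@zclose_trans _ _ _ (f x)).
    by apply: dx; apply: le_ball px; lra.
  apply/zclose_sym/dx; case: px => px1 px2.
  split; rewrite /ball /=; move: px1 px2 pq1 pq2 Nd; rewrite /ball /=;
    by move: (_ / N.+1%:R) => c; rewrite !ltr_norml !ler_norml; lra.
split; first exact: nbhsx_ballx.
exists (Num.truncn ((a + b) / (d / 2))) => // N /= hN.
rewrite ltr_pdivrMr ?ltr0Sn // mulrC -ltr_pdivrMr //.
by apply: lt_le_trans (truncnS_gt _) _; rewrite ler_nat ltnS.
Qed.

Lemma continuousD_fun (X : topologicalType) (f h : X -> R) :
  continuous f -> continuous h -> continuous (fun x => f x + h x).
Proof. by move=> fc hc x; apply: (@cvgD _ R^o); [exact: fc|exact: hc]. Qed.

Lemma continuousM_fun c (X : topologicalType) (f : X -> R) :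
  continuous f -> continuous (fun x => c * f x).
Proof. by move=> fc x; apply: (@cvgMr R); exact: fc. Qed.

Lemma continuous_sum (X : topologicalType) n (f : 'I_n -> X -> R) :
  (forall k, continuous (f k)) -> continuous (fun x => \sum_(k < n) f k x).
Proof.
elim: n f => [|n IH] f fc.
  by under eq_fun do rewrite big_ord0; move=> x; exact: cvg_cst.
under eq_fun do rewrite big_ord_recr; apply: continuousD_fun => //; exact: IH.
Qed.

(* The lift of [f] is the sum of the small increments of [f] along the ray from
   the origin, subdivided into N steps. *)
Lemma zcont_lift a b (f : R * R -> R) : 0 <= a -> 0 <= b ->
    zcont (f \o clamp2 a b) ->
  exists F : R * R -> R, continuous F /\ forall p, rect a b p -> eqZ (F p) (f p).
Proof.
move=> a0 b0 fc; have [N unif] := rect_uniform a b fc.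
pose h k : R := k%:R / N.+1%:R.
have h01 k : (k <= N.+1)%N -> 0 <= h k <= 1.
  by move=> kN; rewrite /h divr_ge0 ?ler0n //= ler_pdivrMr ?ltr0Sn // mul1r ler_nat.
pose d k p := (f \o clamp2 a b) (scale (h k.+1) (clamp2 a b p))
              - (f \o clamp2 a b) (scale (h k) (clamp2 a b p)).
have dc k : zcont (d k).
  have sc j : continuous (scale (h j) \o clamp2 a b).
    by apply: comp_continuous; [exact: clamp2_continuous|exact: scale_continuous].
  exact: zcontD (zcont_comp (sc _) fc) (zcontN (zcont_comp (sc _) fc)).
have ds k p : (k < N.+1)%N -> zclose 4^-1 (d k p) 0.
  move=> kN; have [q1 q2] := clamp2_rect p a0 b0; set q := clamp2 a b p in q1 q2 *.
  have hh : h k.+1 - h k = N.+1%:R^-1.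
    by rewrite /h -mulrBl -natrB // subSnn mul1r.
  have N0 : 0 < N.+1%:R^-1 :> R by rewrite invr_gt0 ltr0Sn.
  have rq : rect a b q by [].
  have sm x y c : 0 <= x <= c -> 0 <= y -> `|h k.+1 * x - h k * x| <= (c + y) / N.+1%:R.
    move=> /andP[x0 xc] y0; rewrite -mulrBl hh ger0_norm ?mulr_ge0 ?(ltW N0) //.
    by rewrite mulrC ler_wpM2r ?(ltW N0) //; lra.
  have [n hn] : zclose 4^-1 ((f \o clamp2 a b) (scale (h k.+1) q))
                            ((f \o clamp2 a b) (scale (h k) q)).
    apply: unif; try (apply: scale_rect => //; apply: h01; lia).
      exact: sm.
    by rewrite [a + b]addrC; apply: sm.
  by exists n; rewrite subr0.
exists (fun p => (f \o clamp2 a b) (0, 0) + \sum_(k < N.+1) residue (d k p)); split.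
  apply: continuousD_fun; first by move=> p; exact: cvg_cst.
  apply: continuous_sum => k; apply: residue_continuous => [|q]; [exact: dc|exact: ds].
move=> p pK.
(* Modulo Z the increments telescope along the ray from the origin to [p]. *)
have tel n : (n <= N.+1)%N -> eqZ ((f \o clamp2 a b) (0, 0) + \sum_(k < n) residue (d k p))
    ((f \o clamp2 a b) (scale (h n) p)).
  elim: n => [_|n IH nN].
    by rewrite big_ord0 addr0 /scale /h !mul0r; exact: eqZ_refl.
  rewrite big_ord_recr /= addrA.
  have -> : f (clamp2 a b (scale (h n.+1) p))
     = (f \o clamp2 a b) (scale (h n) p) + d n p.
    by rewrite /d (clamp2_id pK) /=; ring.
  by apply: eqZD; [exact/IH/ltnW|exact: residue_eqZ].
have := tel _ (leqnn _); rewrite /h divff ?pnatr_eq0 //= /scale !mul1r.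
by rewrite -surjective_pairing (clamp2_id pK).
Qed.

Lemma int_valued_const (f : R -> R) : continuous f ->
  (forall x, 0 <= x <= 1 -> eqZ (f x) 0) -> f 1 = f 0.
Proof.
move=> fc fZ.
have [[n fn] [k fk]] : eqZ (f 0) 0 /\ eqZ (f 1) 0 by split; apply: fZ; lra.
rewrite !subr0 in fn fk; rewrite fn fk; have [->//|nk] := eqVneq n k.
(* If the end values were distinct integers, this half-integer would lie between them and be
   attained. *)
pose v : R := (Num.min n k)%:~R + 2^-1.
have vnk : Num.min (f 0) (f 1) <= v <= Num.max (f 0) (f 1).
  rewrite fn fk /v; have [lt|lt|e] := ltgtP n k; last by rewrite e eqxx in nk.
    have : (n + 1)%:~R <= k%:~R :> R by rewrite ler_int; lia.
    by rewrite intrD => h; rewrite min_l ?max_r; lra.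
  have : (k + 1)%:~R <= n%:~R :> R by rewrite ler_int; lia.
  by rewrite intrD => h; rewrite min_r ?max_l; lra.
have [|c cI fc'] := IVT ler01 _ vnk; first exact: continuous_subspaceT.
have [l] : eqZ (f c) 0 by apply: fZ; rewrite in_itv in cI.
rewrite fc' /v subr0 => h.
have : (2 * Num.min n k + 1)%:~R = (2 * l)%:~R :> R.
  by rewrite !(intrD, intrM) -h; field.
by move/intr_inj; lia.
Qed.

Lemma int_valued_const_seg a b p (f : R * R -> R) : continuous f ->
  (forall q, rect a b q -> eqZ (f q) 0) -> rect a b p -> f p = f (0, 0).
Proof.
move=> fc fZ pK; pose h x := (x * p.1, x * p.2).
have hc : continuous h.
  have mc y : continuous (fun x : R => x * y) by move=> x; exact: mulrr_continuous.
  by apply: pair_continuous; exact: mc.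
have := @int_valued_const (f \o h) (comp_continuous hc fc) _.
rewrite /= /h !mul1r !mul0r -surjective_pairing; apply=> x x01.
by apply: fZ; exact: (@scale_rect a b x p).
Qed.

End ModZ.

(** * Winding numbers *)

Section Winding.
Local Open Scope classical_set_scope.
Local Open Scope ring_scope.
Variables (R : realType) (g : nat).
Local Notation S := (surface R g).
Local Notation strip := (@strip R).
Implicit Types (theta : S -> R) (c : R -> S) (k : R) (p q : R * R).

(* [theta] stands for a map to R / Z, of which [l] is a lift along [c]. *)
Definition wind theta c k := exists l : R -> R,
  [/\ continuous l, forall t : R, 0 <= t <= 1 -> eqZ (l t) (theta (c t)) & l 1 - l 0 = k].

(** Two lifts along the same path differ by a continuous integer-valued function. *)
Lemma wind_uniq theta c k k' : wind theta c k -> wind theta c k' -> k = k'.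
Proof.
move=> [l [lc lt <-]] [l' [lc' lt' <-]].
have : l 1 + - l' 1 = l 0 + - l' 0.
  apply: (@int_valued_const _ (fun t => l t + - l' t)).
    by apply: continuousD_fun => // t; apply: (@cvgN R R^o); exact: lc'.
  move=> t t01; have [n ln] := lt t t01; have [n' ln'] := lt' t t01.
  by exists (n - n'); rewrite intrB -ln -ln'; ring.
lra.
Qed.

Lemma wind_cst theta s : wind theta (fun=> s) 0.
Proof.
exists (fun=> theta s); split=> [t|t _|]; [exact: cvg_cst|exact: eqZ_refl|exact: subrr].
Qed.

Lemma wind_rev theta c k : wind theta c k -> wind theta (path_rev c) (- k).
Proof.
move=> [l [lc lt <-]]; exists (fun t => l (1 - t)); split.
- apply: (comp_continuous _ lc) => t; apply: (@cvgB _ R^o); [exact: cvg_cst|exact: cvg_id].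
- by move=> t t01; apply: lt; lra.
- by rewrite subrr subr0 opprB.
Qed.

Lemma affine_continuous (x y : R) : continuous (fun t : R => x * t + y).
Proof.
apply: continuousD_fun => [|t]; last exact: cvg_cst.
by apply: continuousM_fun => t; exact: cvg_id.
Qed.

Lemma wind_cat theta a b k k' : a 1 = b 0 ->
  wind theta a k -> wind theta b k' -> wind theta (path_cat a b) (k + k').
Proof.
have i1 : 0 <= (1 : R) <= 1 by lra.
have i0 : 0 <= (0 : R) <= 1 by lra.
move=> ab [l [lc lt <-]] [l' [lc' lt' <-]].
have ll' : eqZ (l 1) (l' 0).
  by apply: eqZ_trans (lt 1 i1) _; rewrite ab; apply/eqZ_sym/lt'.
(* On each half one clamped term is constant; subtracting [l' 0] joins the two lifts, since [l 1]
   and [l' 0] agree modulo Z. *)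
clear ab; exists (fun t => l (clamp 1 (2 * t + 0)) + l' (clamp 1 (2 * t + -1)) + - l' 0); split.
- apply: continuousD_fun => [|t]; last exact: cvg_cst.
  apply: continuousD_fun; (apply: comp_continuous; last eassumption);
  (apply: comp_continuous; [exact: affine_continuous|exact: clamp_continuous]).
- move=> t /andP[t0 t1]; rewrite /path_cat; case: (lerP t 2^-1) => t2.
    rewrite (@clamp_le0 _ _ (2 * t + -1)) ?ler01 ?addrK //; last lra.
    by rewrite clamp_id addr0; [apply: lt; lra|lra].
  rewrite (@clamp_ge _ _ (2 * t + 0)) ?ler01 //; last lra.
  rewrite (@clamp_id _ _ (2 * t + -1)); last lra.
  have := eqZD ll' (lt' (2 * t - 1) ltac:(lra)); case=> n h.
  by exists n; rewrite -h; ring.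
- rewrite !(mulr0, mulr1, addr0, add0r) (clamp_le0 ler01 (lexx 0)) (@clamp_le0 _ _ (-1)); [|lra|lra].
  rewrite (@clamp_ge _ _ 2) ?(@clamp_ge _ _ (2 + -1)); try lra; ring.
Qed.

Lemma wind_homotopic theta a b k : zcont theta -> path_homotopic a b ->
  wind theta a k -> wind theta b k.
Proof.
move=> tc [H [Hc Hab Hends]] ka.
have i0 : 0 <= (0 : R) <= 1 by lra.
have i1 : 0 <= (1 : R) <= 1 by lra.
have HZ : zcont ((theta \o H) \o clamp2 1 1).
  rewrite -compA; apply: zcont_comp tc; apply: (@within_comp _ _ _ _ H); last exact: Hc.
    exact: clamp2_continuous.
  by move=> p; apply: clamp2_rect; exact: ler01.
have [F [Fc FH]] := zcont_lift ler01 ler01 HZ.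
have pc (y : R) : continuous (fun t : R => F (t, y)).
  apply: (comp_continuous _ Fc); apply: pair_continuous => t; [exact: cvg_id|exact: cvg_cst].
have pc' (x : R) : continuous (fun t : R => F (x, t)).
  apply: (comp_continuous _ Fc); apply: pair_continuous => t; [exact: cvg_cst|exact: cvg_id].
(* The homotopy is constant on the two vertical sides of the square, hence so is the lift [F]. *)
have end_const (x : R) s : (x = 0 \/ x = 1) -> (forall t, 0 <= t <= 1 -> H (x, t) = s) ->
    F (x, 1) = F (x, 0).
  move=> x01 Hs; have : F (x, 1) + - theta s = F (x, 0) + - theta s.
    apply: (@int_valued_const _ (fun t => F (x, t) + - theta s)).
      by apply: continuousD_fun => // t; exact: cvg_cst.
    move=> t t01; have : eqZ (F (x, t)) (theta s).
      by rewrite -(Hs t t01); apply: FH; split=> //=; case: x01 => ->.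
    by case=> n h; exists n; rewrite subr0.
  by move/addIr.
have wa : wind theta a (F (1, 0) - F (0, 0)).
  exists (fun t => F (t, 0)); split=> // t t01.
  by rewrite -(Hab t t01).1; apply: FH.
exists (fun t => F (t, 1)); split=> // [t t01|].
  by rewrite -(Hab t t01).2; apply: FH.
rewrite (wind_uniq ka wa) (end_const 0 (a 0)) ?(end_const 1 (a 1)) //; try by [left|right].
  by move=> t /Hends[].
by move=> t /Hends[].
Qed.

(** * Winding numbers are unchanged by a twist whose core has winding number 0 *)

Section Twist.
Variables (theta : S -> R) (e : R * R -> S) (T : S -> S) (F : R * R -> R).
Hypotheses (hS : hausdorff_space S) (ee : annulus_embedding e).
Hypotheses (Tc : continuous T) (eT : twist_along e T).
(** The lift is taken on width 2 because the twist moves (u, t), with u and t in [0, 1], to first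
    coordinate u + t. *)
Hypotheses (Fc : continuous F) (Fe : forall p, rect 2 1 p -> eqZ (F p) (theta (e p))).
(* [theta] does not wind around the core of the annulus. *)
Hypothesis F0 : F (1, 0) = F (0, 0).

Let K : set (R * R) := rect 1 1.

Lemma annulus_rep p : strip p -> exists2 q, K q & e q = e p.
Proof.
move=> sp; exists (p.1 - (Num.floor p.1)%:~R, p.2).
  split=> //=; have := floor_itv p.1; rewrite intrD; lra.
apply/ee.2 => //; split=> //=; exists (- Num.floor p.1).
by rewrite mulrNz.
Qed.

Lemma rect_strip a p : rect a 1 p -> strip p.
Proof. by case. Qed.

(** The increment over one turn is continuous and integer-valued, hence constant, and [F0] says that
    it vanishes at the origin. *)
Lemma lift_periodic p : K p -> F (p.1 + 1, p.2) = F p.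
Proof.
move=> pK; pose h p := F (p.1 + 1, p.2) + - F p.
suff : h p = h (0, 0) by rewrite /h /= add0r F0; lra.
apply: (@int_valued_const_seg _ 1 1) pK.
  apply: continuousD_fun => [|q]; last by apply: (@cvgN R R^o); exact: Fc.
  apply: (comp_continuous _ Fc); apply: pair_continuous; last exact: snd_continuous.
  apply: continuousD_fun => [|q]; [exact: fst_continuous|exact: cvg_cst].
move=> q [q1 q2]; have [n hn] : eqZ (F q) (theta (e q)).
  by apply: Fe; split=> //; lra.
have [k hk] : eqZ (F (q.1 + 1, q.2)) (theta (e (q.1 + 1, q.2))).
  by apply: Fe; split=> //=; lra.
exists (k - n); rewrite intrB -hn -hk (_ : e (q.1 + 1, q.2) = e q) /h; first ring.
by apply/ee.2 => //; split=> //; exists 1.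
Qed.

Definition shear p := F (p.1 + p.2, p.2) + - F p.

Lemma shear_continuous : continuous shear.
Proof.
apply: continuousD_fun => [|q]; last by apply: (@cvgN R R^o); exact: Fc.
apply: (comp_continuous _ Fc); apply: pair_continuous; last exact: snd_continuous.
by apply: continuousD_fun => [|q]; [exact: fst_continuous|exact: snd_continuous].
Qed.

Lemma shear_eq p q : K p -> K q -> e p = e q -> shear p = shear q.
Proof.
wlog: p q / p.1 <= q.1 => [shear_le|].
  move=> pK qK pq; case/orP: (le_total p.1 q.1) => h; first exact: shear_le.
  by apply/esym/shear_le => //; exact/esym.
move=> xx pK qK /(ee.2 _ _ pK.2 qK.2)[[k pqk] pq2].
case: p q pK qK pqk pq2 xx => [x y] [x' y'] pK qK /= xk yy xx; rewrite -{y'}yy in qK *.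
have [x0 x1] := (pK.1, qK.1); rewrite /= in x0 x1.
(* Two points of the unit square with the same image are equal or face each other on the sides u = 0
   and u = 1, where periodicity at (0, y) and (y, y) concludes. *)
have k1 : k = 0 \/ k = -1.
  have : (- 2)%:~R < k%:~R :> R by rewrite mulrNz; lra.
  have : k%:~R < 1%:~R :> R by lra.
  rewrite !ltr_int; lia.
case: k1 => kE; first by congr shear; congr pair; rewrite xk kE addr0.
move: xk; rewrite kE => xk.
have [x0' x1'] : x = 0 /\ x' = 1 by move: xk; rewrite mulrNz; lra.
rewrite /shear /= x0' x1' add0r.
have yK : K (y, y) by split; exact: pK.2.
have y0 : K (0, y) by split=> /=; [lra|exact: pK.2].
have := lift_periodic y0; have := lift_periodic yK; rewrite /= add0r addrC => -> ->.
by [].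
Qed.

(** The twist is the identity at t = 0 and a full turn at t = 1. *)
Lemma shear_end p : K p -> p.2 = 0 \/ p.2 = 1 -> shear p = 0.
Proof.
move=> pK [p2|p2]; rewrite /shear.
  by rewrite p2 addr0 -[in F (_, _)]p2 -surjective_pairing subrr.
by have := lift_periodic pK; rewrite p2 => ->; rewrite subrr.
Qed.

(* The lift of [theta \o T - theta], 0 outside the annulus. *)
Definition twist_gap (s : S) : R :=
  if pselect (exists2 p, K p & e p = s) is left h then shear (projT1 (cid2 h)) else 0.

Lemma twist_gapE p : K p -> twist_gap (e p) = shear p.
Proof.
move=> pK; rewrite /twist_gap; case: pselect => [h|[]]; last by exists p.
by case: (cid2 h) => q qK qp /=; exact: shear_eq.
Qed.

Lemma twist_gap_off s : ~ (e @` strip) s -> twist_gap s = 0.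
Proof.
move=> ns; rewrite /twist_gap; case: pselect => // -[p pK ps]; exfalso; apply: ns.
by exists p => //; exact: rect_strip pK.
Qed.

Lemma twist_gap_eqZ s : eqZ (theta (T s)) (theta s + twist_gap s).
Proof.
have [[p sp <-]|ns] := pselect ((e @` strip) s); last first.
  by rewrite eT.2 // twist_gap_off // addr0; exact: eqZ_refl.
have [q qK <-] := annulus_rep sp; have [q1 q2] := qK.
rewrite eT.1 // twist_gapE //.
have [n hn] : eqZ (F q) (theta (e q)) by apply: Fe; split=> //; lra.
have [k hk] : eqZ (F (q.1 + q.2, q.2)) (theta (e (q.1 + q.2, q.2))).
  by apply: Fe; split=> //=; lra.
by exists (n - k); rewrite intrB -hn -hk /shear; ring.
Qed.

Lemma fixed_closed : closed [set s | T s = s].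
Proof.
rewrite -openC openE => s /= /eqP Ts.
have := hS; rewrite open_hausdorff => /(_ _ _ Ts) [[A B] /= [sA sB] [oA oB /eqP AB]].
rewrite inE in sA; rewrite inE in sB.
have nA : \forall s' \near s, A (T s').
  by apply: Tc; exact: open_nbhs_nbhs.
have nB : \forall s' \near s, B s' by exact: open_nbhs_nbhs.
near=> s' => Ts'; suff : (A `&` B) s' by rewrite AB.
by split; [rewrite -Ts'|]; near: s'.
Unshelve. all: end_near. Qed.

(* As T is continuous and fixes the complement of the annulus, so does it on
   the closure of the complement, which hence meets the annulus in its
   boundary only, where the gap vanishes. *)
Lemma twist_gap_continuous : continuous twist_gap.
Proof.
apply/continuous_closedP => C clC.
have clE : closed (e @` (K `&` shear @^-1` C)).
  apply: compact_closed => //; apply: continuous_compact.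
    apply: continuous_subspaceW ee.1 => p [pK _]; exact: rect_strip pK.
  apply: compact_closedI; first exact: rect_compact.
  by move/continuous_closedP: shear_continuous; exact.
(* A fixed point (u, t) of the annulus has u + t equal to u modulo Z, so it lies on an end
   circle. *)
have fixE s : T s = s -> twist_gap s = 0.
  have [[p sp <-]|ns _] := pselect ((e @` strip) s); last exact: twist_gap_off.
  have [q qK <-] := annulus_rep sp; rewrite eT.1; last exact: rect_strip qK.
  move/ee.2 => /= /(_ (rect_strip qK) (rect_strip qK)) [[k kq] _].
  rewrite twist_gapE // shear_end //; have q2k : q.2 = k%:~R by lra.
  have := qK.2; rewrite q2k -[0]/(0%:~R) -[1]/(1%:~R) !ler_int => k01.
  have [->|->] : k = 0 \/ k = 1 by lia. 
    by left.
  by right.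
(* The points off the annulus have gap 0: they belong to the preimage of [C] exactly when [C]
   contains 0, and then they are covered by the closed fixed set. *)
have [C0|nC0] := pselect (C 0).
  suff -> : twist_gap @^-1` C = e @` (K `&` shear @^-1` C) `|` [set s | T s = s].
    by apply: closedU => //; exact: fixed_closed.
  apply/seteqP; split=> [s Cs|s [[p [pK Cp] <-]|Ts]] /=; last by rewrite fixE.
    have [[p sp ps]|ns] := pselect ((e @` strip) s); last by right; exact: eT.2.
    have [q qK qp] := annulus_rep sp; left; exists q; last by rewrite qp.
    by split=> //=; rewrite -twist_gapE // qp ps.
  by rewrite twist_gapE.
suff -> : twist_gap @^-1` C = e @` (K `&` shear @^-1` C) by [].
apply/seteqP; split=> [s Cs|s [p [pK Cp] <-]] /=; last by rewrite twist_gapE.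
have [[p sp ps]|ns] := pselect ((e @` strip) s); last first.
  by exfalso; apply: nC0; rewrite -(twist_gap_off ns).
have [q qK qp] := annulus_rep sp; exists q; last by rewrite qp.
by split=> //=; rewrite -twist_gapE // qp ps.
Qed.

(** Adding [twist_gap] along [c] lifts [theta] on the twisted loop; as [c] is closed, the added term
    has equal end values. *)
Lemma wind_twist c k : continuous (c \o clamp 1) -> c 0 = c 1 ->
  wind theta c k -> wind theta (T \o c) k.
Proof.
have i1 : 0 <= (1 : R) <= 1 by lra.
have i0 : 0 <= (0 : R) <= 1 by lra.
move=> cc c01 [l [lc lt <-]].
exists (fun t => l t + (twist_gap \o (c \o clamp 1)) t); split.
- apply: continuousD_fun => //.
  by apply: comp_continuous; [exact: cc|exact: twist_gap_continuous].
- move=> t t01; rewrite /= clamp_id //; apply: eqZ_trans; last exact/eqZ_sym/twist_gap_eqZ.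
  by apply: eqZD; [exact: lt|exact: eqZ_refl].
- by rewrite /= !clamp_id // c01; ring.
Qed.

End Twist.
End Winding.

(** * Maps from the surface to R / Z *)

Local Open Scope quotient_scope.

Section SurfaceFunctions.
Local Open Scope classical_set_scope.
Local Open Scope ring_scope.
Variables (R : realType) (g : nat).
Local Notation S := (surface R g).
Local Notation polygon := (set_type (@rectangle R g)).
Local Notation pt := (@pt R g).
Local Notation gen_loop := (@gen_loop R g).

Lemma val_pt (x y : R) : 0 <= x <= (4 * g)%:R -> 0 <= y <= 1 -> val (pt x y) = (x, y).
Proof. by move=> hx hy; rewrite /pt insubdK //; exact/mem_set. Qed.

Definition descends (f : R * R -> R) := continuous f /\
  forall p q : polygon, edge_glue p q -> eqZ (f (val p)) (f (val q)).

(** When [f] descends, another representative changes the value by an integer only. *)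
Definition on_surface (f : R * R -> R) (s : S) : R := f (val (repr s : polygon)).

Lemma on_surface_pi f (p : polygon) : descends f ->
  eqZ (on_surface f (\pi_S p)) (f (val p)).
Proof.
move=> [_ fg]; rewrite /on_surface.
have : \pi_S (repr (\pi_S p)) = \pi_S p by rewrite reprK.
move/eqmodP/asboolP; move: (repr _) => q; elim=> {p q} [p q /fg //|p|p q _|p q r _ pq _].
- exact: eqZ_refl.
- exact: eqZ_sym.
- exact: eqZ_trans.
Qed.

Lemma on_surface_zcont f : descends f -> zcont (on_surface f).
Proof.
move=> fd s e e0; set c := on_surface f s.
have oU : open [set s' | zclose e (on_surface f s') c].
  have : open [set p : polygon | zclose e (f (val p)) c].
    rewrite openE => p [n /= pn].
    have fc : continuous (f \o (val : polygon -> _)).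
      by apply: comp_continuous fd.1; exact: initial_continuous.
    have d0 : 0 < e - `|f (val p) - c - n%:~R| by lra.
    have /cvgrPdist_lt/(_ _ d0) := fc p.
    rewrite /interior; apply: filterS => q /= pq; exists n.
    have := ler_normB (f (val p) - c - n%:~R) (f (val p) - f (val q)).
    by rewrite (_ : _ - _ - (_ - _) = f (val q) - c - n%:~R); [lra|ring].
  suff eqU : (\pi_S : polygon -> S) @^-1` [set s' | zclose e (on_surface f s') c]
      = [set p | zclose e (f (val p)) c] by rewrite /open /= /quotient_open eqU.
  apply/seteqP; split=> p /=.
    by apply: zclose_eqZ; [exact: on_surface_pi|exact: eqZ_refl].
  by apply: zclose_eqZ; [exact/eqZ_sym/on_surface_pi|exact: eqZ_refl].
exact: (open_nbhs_nbhs (conj oU (zclose_refl _ e0))).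
Qed.

Definition edge_start (a : surface_gen g) : nat :=
  match a with inl j => (4 * j).+1 | inr j => (4 * j)%N end.

Lemma edge_start_le a : (edge_start a + 3 <= 4 * g)%N.
Proof. by case: a => j /=; have := ltn_ord j; lia. Qed.

(** The starts are 0 or 1 modulo 4. The excluded differences are those for which an edge of [b]
    would meet a sloping part of the profile of [a]. *)
Lemma edge_start_diff a b (d : int) : d = (edge_start b)%:Z - (edge_start a)%:Z ->
  a <> b -> [/\ d <> 0, d <> 2 & d <> - 2].
Proof.
by case: a => i; case: b => j /= -> ab; split=> dE; try lia;
  apply: ab; congr (_ _); apply: val_inj => /=; lia.
Qed.

(* Rises from 0 to 1 on [0, 1], falls back on [2, 3]: shifted to the edge of a
   generator, it takes equal values on glued points of this edge, and integral
   values on the edges of the other generators. *)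
Definition profile (x : R) : R := clamp 1 x - clamp 1 (x - 2).

Lemma profile_continuous : continuous profile.
Proof.
apply: continuousD_fun; first exact: clamp_continuous.
move=> x; apply: (@cvgN R R^o); move: x.
apply: (@comp_continuous _ _ _ (fun x : R => x - 2)); last exact: clamp_continuous.
by move=> x; apply: (@cvgB _ R^o); [exact: cvg_id|exact: cvg_cst].
Qed.

Lemma profile_up t : 0 <= t <= 1 -> profile t = t.
Proof.
by move=> t01; rewrite /profile clamp_id // (@clamp_le0 _ _ (t - 2)) ?subr0 //; lra.
Qed.

Lemma profile_down t : 0 <= t <= 1 -> profile (3 - t) = t.
Proof.
move=> t01; rewrite /profile (@clamp_ge _ _ (3 - t)) ?(@clamp_id _ _ (3 - t - 2)) //; lra.
Qed.

Lemma profile_int (n : int) t : n <> 0 -> n <> 2 -> 0 <= t <= 1 ->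
  profile (n%:~R + t) = (n == 1)%:R.
Proof.
move=> n0 n2 /andP[t0 t1]; rewrite /profile.
have [nN|nP] := ltP n 0.
  have : n%:~R <= (-1)%:~R :> R by rewrite ler_int; lia.
  rewrite mulrNz => h; rewrite !clamp_le0 ?ler01 ?subrr //; try lra.
  by case: eqP => //; lia.
have [->|n1] := eqVneq n 1.
  by rewrite clamp_ge ?clamp_le0 ?ler01 ?subr0 //; lra.
have : 3%:~R <= n%:~R :> R by rewrite ler_int; lia.
by move=> h; rewrite !clamp_ge ?ler01 ?subrr //; lra.
Qed.

(** The circle-valued map dual to the generator [a]. *)
Definition angle (a : surface_gen g) (p : R * R) : R := profile (p.1 - (edge_start a)%:R).

Lemma glue_edges (p q : polygon) : edge_glue p q -> exists a (t : R),
  [/\ 0 <= t <= 1, val p = ((edge_start a)%:R + t, 1)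
    & val q = ((edge_start a)%:R + (3 - t), 1)].
Proof.
case=> j t /andP[t0 t1]; have := ltn_ord j => jg;
  have j4 : (4 * j)%:R + 4 <= (4 * g)%:R :> R by rewrite -natrD ler_nat; lia.
- have j0 : 0 <= (4 * j)%:R :> R by rewrite ler0n.
  exists (inr j), t; rewrite /= t0 t1 !val_pt; try lra.
  by split=> //; congr pair; ring.
- have j0 : 0 <= (4 * j)%:R :> R by rewrite ler0n.
  exists (inl j), t; rewrite /= t0 t1 !val_pt; try lra.
  by split=> //; congr pair; rewrite -natr1; ring.
Qed.

Lemma angle_edge a b t : 0 <= t <= 1 ->
  angle a ((edge_start b)%:R + t, 1) = profile (((edge_start b)%:Z - (edge_start a)%:Z)%:~R + t).
Proof. by move=> t01; rewrite /angle /= intrB; congr profile; rewrite !pmulrn; ring. Qed.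

Lemma angle_descends a : descends (angle a).
Proof.
split.
  apply: (comp_continuous _ profile_continuous).
  apply: continuousD_fun => [|x]; [exact: fst_continuous|exact: cvg_cst].
move=> p q /glue_edges[b [t [t01 -> ->]]].
have t01' : 0 <= 1 - t <= 1 by lra.
rewrite /angle /=.
set d : int := (edge_start b)%:Z - (edge_start a)%:Z.
have dE x : (edge_start b)%:R + x - (edge_start a)%:R = d%:~R + x :> R.
  by rewrite /d intrB !pmulrn; ring.
rewrite !dE; have [ab|ab] := pselect (a = b).
  rewrite /d ab subrr !add0r profile_up // profile_down //; exact: eqZ_refl.
(* On the edges of another generator, both glued points get integral values; the second one is
   written from the start [d + 2] of its edge. *)
have [d0 d2 d2'] := edge_start_diff (erefl d) ab.
rewrite profile_int // (_ : d%:~R + (3 - t) = (d + 2)%:~R + (1 - t)); last by rewrite intrD; ring.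
rewrite profile_int //; try lia.
by exists ((d == 1)%:Z - (d + 2 == 1)%:Z); rewrite intrB.
Qed.

Lemma gen_loopE a t : gen_loop a t = \pi_S (pt ((edge_start a)%:R + t) 1).
Proof. by case: a => j //=; rewrite -natr1. Qed.

Lemma val_edge_pt a t : 0 <= t <= 1 ->
  val (pt ((edge_start a)%:R + t) 1) = ((edge_start a)%:R + t, 1).
Proof.
move=> t01; have := edge_start_le a; rewrite -(ler_nat R) natrD => ag.
have a0 : 0 <= (edge_start a)%:R :> R by rewrite ler0n.
by rewrite val_pt //; lra.
Qed.

Local Notation theta a := (on_surface (angle a)).

Lemma theta_loop a b t : 0 <= t <= 1 -> eqZ (theta a (gen_loop b t))
  (profile (((edge_start b)%:Z - (edge_start a)%:Z)%:~R + t)).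
Proof.
move=> t01; rewrite gen_loopE; apply: eqZ_trans (on_surface_pi _ (angle_descends a)) _.
by rewrite val_edge_pt // angle_edge //; exact: eqZ_refl.
Qed.

Lemma theta_loop_same a t : 0 <= t <= 1 -> eqZ (theta a (gen_loop a t)) t.
Proof. by move=> t01; have := theta_loop a a t01; rewrite subrr add0r profile_up. Qed.

Lemma theta_loop_diff a b t : a <> b -> 0 <= t <= 1 -> eqZ (theta a (gen_loop b t)) 0.
Proof.
move=> ab t01; apply: eqZ_trans (theta_loop a b t01) _.
have [d0 d2 _] := edge_start_diff (erefl _) ab.
by rewrite profile_int //; exact: (eqZ_int R (_ == 1 : nat)%:Z).
Qed.

Lemma wind_gen_loop a b : wind (theta a) (gen_loop b) (a == b)%:R.
Proof.
set d : int := (edge_start b)%:Z - (edge_start a)%:Z.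
exists (fun t => profile (1 * t + d%:~R)); split.
- by apply: comp_continuous profile_continuous; exact: affine_continuous.
- move=> t t01; rewrite mul1r addrC; exact/eqZ_sym/theta_loop.
- rewrite mulr1 mulr0 ![_ + d%:~R]addrC.
  have [ab|/eqP ab] := eqVneq a b.
    by rewrite /d ab subrr !add0r !profile_up ?subr0 //; lra.
  have [d0 d2 _] := edge_start_diff (erefl d) ab.
  by rewrite !profile_int ?subrr //; lra.
Qed.

Lemma gen_loop_continuous a : continuous (gen_loop a \o clamp 1).
Proof.
have -> : gen_loop a \o clamp 1 =
    (\pi_S : polygon -> S) \o (fun t => pt ((edge_start a)%:R + clamp 1 t) 1).
  by apply/funext => t /=; rewrite gen_loopE.
apply: comp_continuous; last exact: pi_continuous.
apply/continuous_comp_initial.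
have -> : set_val \o (fun t => pt ((edge_start a)%:R + clamp 1 t) 1) =
   (fun t => ((edge_start a)%:R + clamp 1 t, 1)).
  by apply/funext => t; apply: val_edge_pt; exact: clamp_itv ler01.
apply: pair_continuous => [|t]; last exact: cvg_cst.
by apply: continuousD_fun => [t|]; [exact: cvg_cst|exact: clamp_continuous].
Qed.

End SurfaceFunctions.

(** * The surface is Hausdorff: maps to R / Z separate its points *)

Section Hausdorff.
Local Open Scope classical_set_scope.
Local Open Scope ring_scope.
Variables (R : realType) (g : nat).
Local Notation S := (surface R g).
Local Notation polygon := (set_type (@rectangle R g)).
Local Notation pt := (@pt R g).
Local Notation gen_loop := (@gen_loop R g).
Local Notation base := (base_point R g).
Local Notation theta a := (@on_surface R g (@angle R g a)).

Lemma eqZ_lt1 (x y : R) : eqZ x y -> `|x - y| < 1 -> x = y.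
Proof. by case=> n xy; rewrite xy => /int_lt1 n0; move: xy; rewrite n0; lra. Qed.

Lemma zclose_eqZ_all (x y : R) : (forall e, 0 < e -> zclose e x y) -> eqZ x y.
Proof.
move=> xy; have := floor_itv (x - y); set n := Num.floor _; rewrite intrD => /andP[nx xn].
have [|lt] := leP (x - y) n%:~R; first by move=> xn'; exists n; lra.
have [m] := xy (Num.min (x - y - n%:~R) (n%:~R + 1 - (x - y))) ltac:(rewrite lt_min; lra).
rewrite lt_min !ltr_norml => /andP[/andP[m1 m2] /andP[m3 m4]].
have : n%:~R < m%:~R :> R by lra.
have : m%:~R < (n + 1)%:~R :> R by rewrite intrD; lra.
rewrite !ltr_int; lia.
Qed.

Lemma zcont_hausdorff :
  (forall s s' : S, (forall f : S -> R, zcont f -> eqZ (f s) (f s')) -> s = s') ->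
  hausdorff_space S.
Proof.
move=> sep s s' ss'; apply: sep => f fc; apply: zclose_eqZ_all => e e0.
have e2 : 0 < e / 2 by lra.
have [u [us us']] := ss' _ _ (fc s _ e2) (fc s' _ e2).
by rewrite [e]splitr; apply: zclose_trans us'; exact: zclose_sym.
Qed.

Lemma glue_pi (p q : polygon) : edge_glue p q -> \pi_S p = \pi_S q.
Proof. by move=> pq; apply/eqmodP/asboolP; exact: Relation_Operators.rst_step. Qed.

Lemma glue_y_pi (j : 'I_g) (t : R) : 0 <= t <= 1 ->
  \pi_S (pt ((4 * j)%:R + 3 - t) 1) = gen_loop (inr j) t.
Proof. by move=> t01; rewrite /= (glue_pi (edge_glue_y j t01)). Qed.

Lemma glue_x_pi (j : 'I_g) (t : R) : 0 <= t <= 1 ->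
  \pi_S (pt ((4 * j)%:R + 4 - t) 1) = gen_loop (inl j) t.
Proof. by move=> t01; rewrite /= (glue_pi (edge_glue_x j t01)). Qed.

(** In each block the gluings at t = 0 and t = 1 chain the vertices 4j, 4j + 3, 4j + 2, 4j + 1, 4j +
    4. *)
Lemma vertex_base k : (k <= 4 * g)%N -> \pi_S (pt k%:R 1) = base.
Proof.
pose V k := \pi_S (pt k%:R 1) : S.
have i0 : 0 <= (0 : R) <= 1 by lra.
have i1 : 0 <= (1 : R) <= 1 by lra.
have sq (j : 'I_g) : [/\ V (4 * j)%N = V (4 * j + 3)%N, V (4 * j + 1)%N = V (4 * j + 2)%N,
    V (4 * j + 1)%N = V (4 * j + 4)%N & V (4 * j + 2)%N = V (4 * j + 3)%N].
  have := (glue_y_pi j i0, glue_y_pi j i1, glue_x_pi j i0, glue_x_pi j i1).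
  rewrite /= !addr0 !subr0 => -[[[a b] c] d].
  have VD n : V (4 * j + n)%N = \pi_S (pt ((4 * j)%:R + n%:R) 1) by rewrite /V natrD.
  rewrite !VD /V; split; [by rewrite a|rewrite -b|by rewrite c|].
    by congr (\pi_S (pt _ _)); ring.
  rewrite (_ : (4 * j)%:R + 2 = (4 * j)%:R + 1 + 1); last ring.
  by rewrite -d; congr (\pi_S (pt _ _)); ring.
have V4 j : (j <= g)%N -> V (4 * j)%N = base.
  elim: j => [_|j IH jg].
    rewrite /V muln0 /base_point; congr (\pi_S _); apply: val_inj.
    by rewrite val_pt //= ?lexx ?ler0n ?ler01.
  have [a b c d] := sq (Ordinal jg); rewrite /= in a b c d.
  by rewrite mulnS addnC -c b d -a IH // ltnW.
move=> kg; rewrite -/(V k) (divn_eq k 4) mulnC.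
have [k0|kn] := eqVneq (k %% 4)%N 0%N; first by rewrite k0 addn0 V4 //; lia.
have jg : (k %/ 4 < g)%N by lia.
have [a b c d] := sq (Ordinal jg); rewrite /= in a b c d.
rewrite -(V4 _ (ltnW jg)) a; have : (k %% 4 < 4)%N by rewrite ltn_mod.
case: (k %% 4)%N kn => [|[|[|[|]]]] // _ _; by rewrite ?b ?d.
Qed.

Lemma gen_loop_base a : gen_loop a 0 = base /\ gen_loop a 1 = base.
Proof.
have ag := edge_start_le a.
by rewrite !gen_loopE addr0 natr1 !vertex_base //; lia.
Qed.

Lemma top_side (x : R) : 0 <= x <= (4 * g)%:R -> \pi_S (pt x 1) = base \/
  exists a t, 0 < t < 1 /\ \pi_S (pt x 1) = gen_loop a t.
Proof.
move=> /andP[x0 xg]; have := truncn_itv x0; set k := Num.truncn x => /andP[kx xk].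
have kg : (k <= 4 * g)%N by rewrite -(ler_nat R); exact: le_trans xg.
have [->|xnk] := eqVneq x k%:R; first by left; exact: vertex_base.
have {}kx : k%:R < x by rewrite lt_neqAle eq_sym xnk.
have {}kg : (k < 4 * g)%N by rewrite -(ltr_nat R); exact: lt_le_trans xg.
have jg : (k %/ 4 < g)%N by lia.
pose j := Ordinal jg; right.
have kE : (k = 4 * j + k %% 4)%N by rewrite /= mulnC -divn_eq.
move: kx xk; rewrite -natr1 {1 2}kE natrD.
have : (k %% 4 < 4)%N by rewrite ltn_mod.
(* The remainder selects the letter y, x, y^-1 or x^-1; the inverse letters are run backwards
   through the gluing. *)
case: (k %% 4)%N => [|[|[|[|]]]] // _ kx xk.
- exists (inr j), (x - (4 * j)%:R); split; first by lra.
  by rewrite /=; congr (\pi_S (pt _ _)); ring.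
- exists (inl j), (x - (4 * j)%:R - 1); split; first by lra.
  by rewrite /=; congr (\pi_S (pt _ _)); ring.
- exists (inr j), ((4 * j)%:R + 3 - x); split; first by lra.
  by rewrite -glue_y_pi; [congr (\pi_S (pt _ _)); ring|lra].
- exists (inl j), ((4 * j)%:R + 4 - x); split; first by lra.
  by rewrite -glue_x_pi; [congr (\pi_S (pt _ _)); ring|lra].
Qed.

Lemma theta_base a : eqZ (theta a base) 0.
Proof. by rewrite -(gen_loop_base a).1; apply: theta_loop_same; lra. Qed.

(** The map dual to [a] is not integral at an interior point of the loop [a], whereas it is integral
    at the base point and on the other loops. *)
Lemma theta_separates a t s : 0 < t < 1 -> (s = base \/
    exists b u, 0 < u < 1 /\ s = gen_loop b u) ->
  (forall c, eqZ (theta c (gen_loop a t)) (theta c s)) -> gen_loop a t = s.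
Proof.
move=> t01 s_or ts.
have t01' : 0 <= t <= 1 by lra.
have {ts} ts : eqZ t (theta a s).
  exact: eqZ_trans (eqZ_sym (theta_loop_same _ t01')) (ts a).
have t0 : ~ eqZ t 0 by move/eqZ_lt1; rewrite subr0 ger0_norm; lra.
case: s_or => [sE|[b [u [u01 sE]]]]; subst s.
  by case: t0; exact: eqZ_trans ts (theta_base a).
have u01' : 0 <= u <= 1 by lra.
have [ab|ab] := pselect (a = b); last first.
  by case: t0; exact: eqZ_trans ts (theta_loop_diff ab u01').
subst b; congr gen_loop; apply: eqZ_lt1; first exact: eqZ_trans ts (theta_loop_same a u01').
by rewrite ltr_norml; lra.
Qed.

Lemma surface_hausdorff : hausdorff_space S.
Proof.
apply: zcont_hausdorff => s s'; rewrite -[s]reprK -[s']reprK => ss'.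
move: (repr s) (repr s') ss' => p q pq {s s'}.
have fpq f : descends g f -> eqZ (f (val p)) (f (val q)).
  move=> fd; have := pq _ (on_surface_zcont fd) => h.
  exact: eqZ_trans (eqZ_sym (on_surface_pi p fd)) (eqZ_trans h (on_surface_pi q fd)).
have [[/andP[p1 p1'] /andP[p2 p2']] [/andP[q1 q1'] /andP[q2 q2']]] := (set_valP p, set_valP q).
have fst2 : (val p).2 = (val q).2.
  (* Halving keeps the heights in [0, 1/2], where equality modulo Z is equality. *)
  have fd : descends g (fun r : R * R => 2^-1 * r.2).
    split; first by apply: continuousM_fun; exact: snd_continuous.
    by move=> p' q' /glue_edges[a [t [_ -> ->]]]; exact: eqZ_refl.
  have := eqZ_lt1 (fpq _ fd) ltac:(rewrite ltr_norml; lra); lra.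
have [top|ntop] := eqVneq (val p).2 1.
  have ptE (r : polygon) : (val r).2 = 1 -> r = pt (val r).1 1.
    move=> r2; have [r1 _] := set_valP r; apply: val_inj; rewrite val_pt //; last by lra.
    by rewrite -[in RHS]r2 -surjective_pairing.
  have tp := ptE p top; have tq := ptE q (etrans (esym fst2) top).
  rewrite tp tq in pq *.
  have sp := @top_side (val p).1 ltac:(lra); have sq := @top_side (val q).1 ltac:(lra).
  have th c := pq _ (on_surface_zcont (@angle_descends R g c)).
  case: (sp) => [pb|[a [t [t01 pE]]]]; last first.
    by rewrite pE; apply: theta_separates => // c; rewrite -pE; exact: th.
  case: (sq) => [qb|[a [t [t01 qE]]]]; first by rewrite pb qb.
  by rewrite qE; apply/esym/theta_separates => // c; rewrite -qE; apply/eqZ_sym/th.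
have y1 : (val p).2 < 1 by rewrite lt_neqAle ntop.
have g1 : 0 < ((4 * g)%:R + 1 : R)^-1 by rewrite invr_gt0 natr1 ltr0Sn.
(* The factor 1 - y vanishes on the glued side, and the division by 4g + 1 keeps the values in [0,
   1). Below the top this recovers x once y is known. *)
have fd : descends g (fun r : R * R => ((4 * g)%:R + 1)^-1 * ((1 - r.2) * r.1)).
  split.
    apply: continuousM_fun => r; apply: (@cvgM R); last exact: fst_continuous.
    by apply: (@cvgB _ R^o); [exact: cvg_cst|exact: snd_continuous].
  by move=> p' q' /glue_edges[a [t [_ -> ->]]]; rewrite /= subrr !mul0r; exact: eqZ_refl.
have bound (x y : R) : 0 <= x <= (4 * g)%:R -> 0 <= y < 1 ->
    0 <= ((4 * g)%:R + 1)^-1 * ((1 - y) * x) < 1.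
  move=> /andP[x0 xg] /andP[y0 y1']; rewrite !mulr_ge0 ?(ltW g1) //=; last by lra.
  rewrite mulrC ltr_pdivrMr ?mul1r; last by rewrite natr1 ltr0Sn.
  by apply: (@le_lt_trans _ _ x); [rewrite ler_piMl //; lra|lra].
have := bound _ _ (introT andP (conj p1 p1')) (introT andP (conj p2 y1)).
have qy1 : (val q).2 < 1 by rewrite -fst2.
have := bound _ _ (introT andP (conj q1 q1')) (introT andP (conj q2 qy1)).
move=> bq bp; have := eqZ_lt1 (fpq _ fd) ltac:(rewrite ltr_norml; lra).
rewrite -fst2 => /(mulfI (lt0r_neq0 g1)) /(mulfI _) e1.
congr (\pi_S _); apply: val_inj; rewrite [val p]surjective_pairing [val q]surjective_pairing -fst2.
by congr pair; apply: e1; rewrite subr_eq0 eq_sym.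
Qed.

End Hausdorff.

(** * Weighted exponent sums and winding numbers of words *)

Section Exponents.
Local Open Scope ring_scope.
Variables (R : realType) (g : nat) (wt : surface_gen g -> R).

Definition exponent (w : Defs.word (surface_gen g)) : R :=
  \sum_(l <- w) (if l.2 then wt l.1 else - wt l.1).

Lemma exponent_eq (u v : Defs.word (surface_gen g)) :
  \pi_(pi1 g) u = \pi_(pi1 g) v -> exponent u = exponent v.
Proof.
move/presentedP; elim=> {u v} [_ _ [u v [a b]|//]|//|//|u v w _ -> _ -> //].
rewrite /exponent !big_cat !big_cons /=; congr (_ + _).
by case: b => /=; rewrite addrA ?subrr ?addNr add0r.
Qed.

(** The homomorphism from the free group to the reals that extends [wt]. *)
Definition exponent1 (z : pi1 g) : R := exponent (repr z).

Lemma exponent1_pi u : exponent1 (\pi_(pi1 g) u) = exponent u.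
Proof. by apply: exponent_eq; rewrite reprK. Qed.

Lemma exponent1_gen a : exponent1 (pi1_gen a) = wt a.
Proof. by rewrite exponent1_pi /exponent big_seq1. Qed.

Lemma exponent1M x y : exponent1 (x * y)%g = exponent1 x + exponent1 y.
Proof.
rewrite -[LHS]/(exponent1 (\pi_(pi1 g) (repr x ++ repr y))).
by rewrite exponent1_pi /exponent big_cat.
Qed.

Lemma exponent1J x y : exponent1 (x * y * x^-1)%g = exponent1 y.
Proof.
have V z : exponent1 z^-1%g = - exponent1 z.
  apply/eqP; rewrite eq_sym eqr_oppLR -subr_eq0 opprK addrC -exponent1M mulVg.
  by rewrite (exponent1_pi [::]) /exponent big_nil.
by rewrite !exponent1M V; ring.
Qed.

Lemma letter_loop_ends (l : surface_gen g * bool) :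
  letter_loop l 0 = base_point R g /\ letter_loop l 1 = base_point R g.
Proof.
have [l0 l1] := @gen_loop_base R g l.1.
by rewrite /letter_loop /path_rev; case: l.2; rewrite // subr0 subrr.
Qed.

Lemma word_loop_start (w : Defs.word (surface_gen g)) :
  word_loop (R := R) w 0 = base_point R g.
Proof.
case: w => //= l w; rewrite /path_cat invr_ge0 ler0n mulr0.
by have [] := letter_loop_ends l.
Qed.

Lemma wind_word (theta : surface R g -> R) (w : Defs.word (surface_gen g)) :
    (forall a, wind theta (gen_loop a) (wt a)) ->
  wind theta (word_loop w) (exponent w).
Proof.
move=> wg; elim: w => [|l w IH]; first by rewrite /exponent big_nil; exact: wind_cst.
rewrite /exponent big_cons; apply: wind_cat => //.
  by rewrite (letter_loop_ends l).2; exact/esym/word_loop_start.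
by rewrite /letter_loop; case: l.2; [|apply: wind_rev]; exact: wg.
Qed.

End Exponents.

(** * The images of the braid generators are not Dehn twists *)

Section NotTwist.
Local Open Scope ring_scope.
Variables (R : realType) (g : nat).
Local Notation theta a := (@on_surface R g (@angle R g a)).

Lemma wind_comb (f h : surface R g -> R) (c d : int) (l : R -> surface R g) x y :
  wind f l x -> wind h l y ->
  wind (fun s => c%:~R * f s + d%:~R * h s) l (c%:~R * x + d%:~R * y).
Proof.
move=> [u [uc uf <-]] [v [vc vh <-]]; exists (fun t => c%:~R * u t + d%:~R * v t); split.
- by apply: continuousD_fun; exact: continuousM_fun.
- by move=> t t01; apply: eqZD; apply: eqZM; [exact: uf|exact: vh].
- ring.
Qed.

Lemma beta_not_twist (i : 'I_g.-1) : ~ is_dehn_twist R (beta i).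
Proof.
move=> [T [[Tc _ _] [e ee eT] rT]].
pose x := inl (index_lo i) : surface_gen g; pose y := inr (index_lo i) : surface_gen g.
have zc a := on_surface_zcont (@angle_descends R g a).
have two0 : 0 <= (2 : R) by rewrite ler0n.
have lift a : exists2 F : R * R -> R, continuous F &
    forall p, rect 2 1 p -> eqZ (F p) (theta a (e p)).
  have ec : zcont ((theta a \o e) \o clamp2 2 1).
    suff eC : continuous (e \o clamp2 2 1) by exact: zcont_comp eC (zc a).
    apply: (@within_comp _ _ _ _ e); last exact: ee.1.
      exact: clamp2_continuous.
    by move=> p; have [] := clamp2_rect p two0 (@ler01 R).
  by have [F [Fc Fe]] := zcont_lift two0 (@ler01 R) ec; exists F.
have [Fx Fxc Fxe] := lift x; have [Fy Fyc Fye] := lift y.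
(* The winding number of the core is an integer because [e] identifies (1, 0) and (0, 0). *)
have core (a : surface_gen g) (F : R * R -> R) : (forall p, rect 2 1 p -> eqZ (F p) (theta a (e p))) ->
    exists n : int, F (1, 0) - F (0, 0) = n%:~R.
  move=> Fe; have Fe1 : eqZ (F (1, 0)) (theta a (e (1, 0))) by apply: Fe; split=> /=; lra.
  have Fe0 : eqZ (F (0, 0)) (theta a (e (0, 0))) by apply: Fe; split=> /=; lra.
  rewrite (_ : e (1, 0) = e (0, 0)) in Fe1; first exact: eqZ_trans Fe1 (eqZ_sym Fe0).
  apply/ee.2; [by rewrite /strip /=; lra|by rewrite /strip /=; lra|split=> //].
  by exists 1; rewrite add0r.
have [m mE] := core _ _ Fxe; have [n nE] := core _ _ Fye.
(* Two integers always satisfy a nontrivial integral linear relation: (n, -m) unless m = 0, and (1,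
   0) in that case. *)
have [c [d [cd cd0]]] : exists c d : int, c * m + d * n = 0 /\ (c != 0) || (d != 0).
  have [m0|m0] := eqVneq m 0; last by exists n, (- m); rewrite oppr_eq0 m0 orbT; split=> //; ring.
  by exists 1, 0; rewrite m0 mulr0 mul0r.
pose th s := c%:~R * theta x s + d%:~R * theta y s.
pose wt (a : surface_gen g) : R := c%:~R * (x == a)%:R + d%:~R * (y == a)%:R.
have thc : zcont th by apply: zcontD; apply: zcontM; exact: zc.
have wg a : wind th (gen_loop a) (wt a) by apply: wind_comb; exact: wind_gen_loop.
(* The winding number along the image of the loop [a] is computed twice: the twist preserves it, and
   the image is homotopic to the word of [beta i] at [a]. *)
have key a : wt a = exponent1 wt (val (beta i) (pi1_gen a)).
  apply: (@wind_uniq R g th (word_loop (repr (val (beta i) (pi1_gen a))))); last exact: wind_word.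
  apply: wind_homotopic thc (rT a) _.
  apply: (@wind_twist R g th e T (fun p => c%:~R * Fx p + d%:~R * Fy p)) (wg a) => //.
  - exact: surface_hausdorff.
  - by apply: continuousD_fun; exact: continuousM_fun.
  - by move=> p pK; apply: eqZD; apply: eqZM; [exact: Fxe|exact: Fye].
  - have : (c * m + d * n)%:~R = 0 :> R by rewrite cd.
    by rewrite intrD !intrM -mE -nE; lra.
  - exact: gen_loop_continuous.
  - by have [-> ->] := @gen_loop_base R g a.
have lh : (index_lo i == index_hi i) = false by rewrite eq_sym; exact: hi_lo.
(* The weights live on the lower handle, whose generators [beta i] sends to conjugates of those of
   the upper one; so both coefficients vanish. *)
have wt_hi a : wt (Defs.reindex a (index_hi i)) = 0.
  have nhi b : index_of b = index_lo i -> (b == Defs.reindex a (index_hi i)) = false.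
    move=> bi; apply/eqP => /(congr1 (@index_of g)); rewrite bi index_reindex.
    by move/eqP; rewrite lh.
  by rewrite /wt !nhi // !mulr0 addr0.
have wt_lo a : wt (Defs.reindex a (index_lo i)) = 0.
  by rewrite key beta_val beta_lo exponent1J exponent1_gen wt_hi.
have xy : (x == y) = false by [].
have yx : (y == x) = false by [].
have c0 : c = 0.
  by have := wt_lo x; rewrite /= -/x /wt eqxx yx mulr0 addr0 mulr1 => /eqP; rewrite intr_eq0 => /eqP.
have d0 : d = 0.
  by have := wt_lo y; rewrite /= -/y /wt eqxx xy mulr0 add0r mulr1 => /eqP; rewrite intr_eq0 => /eqP.
by rewrite c0 d0 in cd0.
Qed.

End NotTwist.

Theorem lemma3p7 (R : realType) (g : nat) :
  injective (@phi g) /\ ((1 < g)%N -> ~ is_geometric R (@phi g)).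
Proof.
split=> [|g1 geo]; first exact: phi_inj.
(* With at least two strands there is a first generator, and its image already fails to be a
   twist. *)
have i0 : (0 < g.-1)%N by lia.
by have := geo (Ordinal i0); rewrite phi_sigma; exact: beta_not_twist.
Qed.
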